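(* Let $n\ge 2$, let $\Omega=\{x\in\mathbb{R}^n:|x|<1\}$, and let $\alpha>0$, $\beta>0$ satisfy $\alpha\beta<n^2$. Then the system $$\begin{cases}\det D^2u^1=(-u^2)^{\alpha} & \text{in }\Omega,\\ \det D^2u^2=(-u^1)^{\beta} & \text{in }\Omega,\\ u^1<0,\ u^2<0 & \text{in }\Omega,\\ u^1=u^2=0 & \text{on }\partial\Omega\end{cases}$$ admits a unique convex solution $\mathbf{u}=(u^1,u^2)$, and this solution is radially symmetric and strictly increasing with respect to $0$ (that is, $u^1$ and $u^2$ are strictly increasing functions of $|x|$).
   Context: Solutions are understood in the classical sense, i.e. $u^1,u^2\in C^2(\overline{\Omega})$, and convex solutions are understood to be strictly convex functions in $\Omega$. $D^2u$ denotes the Hessian matrix of $u$. *)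

(* Defs.v *)
From HB Require Import structures.
From mathcomp Require Import all_boot all_order all_algebra.
From mathcomp Require Import all_classical all_reals all_analysis.

Set Implicit Arguments.
Unset Strict Implicit.
Unset Printing Implicit Defensive.

Import Order.TTheory GRing.Theory Num.Theory.
Import numFieldNormedType.Exports.

Local Open Scope classical_set_scope.
Local Open Scope ring_scope.

(* The library norm `|x| on row vectors is the sup norm; the unit ball and
   radial symmetry need the Euclidean one. The topologies coincide. *)
Definition enorm (R : realType) (n : nat) (x : 'rV[R]_n) : R :=
  Num.sqrt (\sum_(i < n) x 0 i ^+ 2).

Definition unit_ball (R : realType) (n : nat) : set 'rV[R]_n :=
  [set x | enorm x < 1].

Definition frontier (T : topologicalType) (D : set T) : set T :=
  closure D `\` D°.

Definition partial (R : realType) (n : nat) (i : 'I_n) (u : 'rV[R]_n -> R) :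
  'rV[R]_n -> R := fun x => 'D_(delta_mx 0 i) u x.

Definition hessian (R : realType) (n : nat) (u : 'rV[R]_n -> R)
    (x : 'rV[R]_n) : 'M[R]_n :=
  \matrix_(i < n, j < n) partial j (partial i u) x.

Definition extends_to_closure (R : realType) (n : nat) (D : set 'rV[R]_n)
    (f : 'rV[R]_n -> R) : Prop :=
  exists g : 'rV[R]_n -> R,
    {within closure D, continuous g} /\ (forall x, D x -> g x = f x).

(* C^2(closure D) for an open set D: u is continuous on closure D, and its
   partial derivatives of orders 1 and 2 exist in D and extend continuously to
   closure D. Only the values of u on closure D matter. *)
Definition C2_closure (R : realType) (n : nat) (D : set 'rV[R]_n)
    (u : 'rV[R]_n -> R) : Prop :=
  [/\ {within closure D, continuous u},
      forall (i : 'I_n) x, D x -> derivable u x (delta_mx 0 i),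
      forall (i j : 'I_n) x, D x -> derivable (partial i u) x (delta_mx 0 j),
      forall i : 'I_n, extends_to_closure D (partial i u)
    & forall i j : 'I_n, extends_to_closure D (partial j (partial i u))].

(* To be used on a convex set D. *)
Definition strictly_convex_on (R : realType) (n : nat) (D : set 'rV[R]_n)
    (u : 'rV[R]_n -> R) : Prop :=
  forall (x y : 'rV[R]_n) (t : R), D x -> D y -> x != y -> 0 < t -> t < 1 ->
    u (t *: x + (1 - t) *: y) < t * u x + (1 - t) * u y.

Definition convex_solution (R : realType) (n : nat) (alpha beta : R)
    (u1 u2 : 'rV[R]_n -> R) : Prop :=
  let Omega := @unit_ball R n in
  [/\ C2_closure Omega u1 /\ C2_closure Omega u2,
      strictly_convex_on Omega u1 /\ strictly_convex_on Omega u2,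
      forall x, Omega x -> \det (hessian u1 x) = (- u2 x) `^ alpha /\
                           \det (hessian u2 x) = (- u1 x) `^ beta,
      forall x, Omega x -> u1 x < 0 /\ u2 x < 0
    & forall x, frontier Omega x -> u1 x = 0 /\ u2 x = 0].

Definition radially_increasing (R : realType) (n : nat)
    (u : 'rV[R]_n -> R) : Prop :=
  exists phi : R -> R,
    {in `[0, 1] &, {homo phi : r s / r < s}} /\
    (forall x, closure (@unit_ball R n) x -> u x = phi (enorm x)).

(* Main.v *)
Require Import Defs.
From HB Require Import structures.
From mathcomp Require Import all_boot all_order all_algebra.
From mathcomp Require Import all_classical all_reals all_analysis.
From mathcomp Require Import ring lra measurable_realfun.

Set Implicit Arguments.
Unset Strict Implicit.
Unset Printing Implicit Defensive.

Import Order.TTheory GRing.Theory Num.Theory.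
Import numFieldNormedType.Exports.

Local Open Scope classical_set_scope.
Local Open Scope ring_scope.

(** Uniqueness uses no symmetry. The comparison principle says that
    det D^2 u <= det D^2 v with v convex and u = v = 0 on the boundary forces
    v <= u. For two solutions u, v, convexity bounds -v1 below and a quadratic
    barrier bounds -u1 above by multiples of 1 - |x|^2, so v1 <= l u1 for some
    l in (0, 1]. Comparing the second components and then the first ones
    improves l to l^p with p = alpha beta / n^2 < 1, hence l = 1 is admissible.

    Existence is a radial construction. For u = - z (|x|) the equation
    det D^2 u = w (|x|)^gamma becomes ((- z')^n)' = n r^(n-1) w^gamma, so z is
    obtained from w by two integrations; composing the two solution operators
    gives a monotone map, homogeneous of degree p < 1, which preserves the
    nonincreasing functions lying above a small multiple of 1 - r and so has a
    fixed point by Knaster and Tarski. In the variable s = |x|^2 this fixed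
    point yields C^2 functions up to the boundary. *)

(** * Calculus of several variables *)

(** [C2_closure] speaks only of coordinate partial derivatives inside the ball, so derivatives in an
    arbitrary direction and the symmetry of the Hessian have to be earned from the continuity of the
    partials; convexity and the maximum principle are then read off on lines. The hypothesis alpha
    beta < n^2 enters twice through p < 1: a number l in (0, 1) satisfies l < l^p, and for fixed k >
    0 a small height c satisfies c <= k c^p. Monotone functions carry the fixed point because they
    are stable under suprema and the integrals make sense on them, with no compactness or continuity
    to check; continuity and C^2 regularity return afterwards, since the fixed point is an integral.
    Two places resist: the centre, where |x| is not smooth, and the sphere, where the solution
    vanishes and its power need not be differentiable. The variable s = |x|^2 settles the first; the
    second is harmless because second derivatives need only be continuous up to the boundary. *)

Lemma is_derive_line (R : realType) (V : normedModType R) (f : V -> R)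
    (z v : V) (s : R) :
  derivable f (z + s *: v) v ->
  is_derive s 1 (fun t => f (z + t *: v)) ('D_v f (z + s *: v)).
Proof.
have E : (fun h : R => h^-1 *: (f (z + (h *: 1 + s) *: v) - f (z + s *: v))) =
    (fun h => h^-1 *: (f (h *: v + (z + s *: v)) - f (z + s *: v))).
  by apply/funext => h; rewrite -mulr_algl scaler1 mulr1 scalerDl addrCA addrA.
move=> fd; split; first by rewrite /derivable /= E.
by rewrite {1}/derive /= E.
Qed.

(** The chain rule with [t |-> c t] at 0, so that [c = 0] needs no separate case. *)
Lemma is_derive_scale_dir (R : realType) (V : normedModType R) (f : V -> R)
    (x v : V) (c : R) :
  derivable f x v -> is_derive x (c *: v) f (c * 'D_v f x).
Proof.
move=> fd.
have d0 : is_derive (c * 0) 1 (fun t => f (x + t *: v)) ('D_v f x).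
  rewrite mulr0; have := @is_derive_line _ _ f x v 0.
  by rewrite scale0r addr0; apply.
have dz : is_derive (0 : R) 1 (c \*: (@id R)) c.
  by have := @is_deriveZ R R R id c 0 1 1 _; rewrite scaler1; apply.
have := is_derive1_comp d0 dz.
have E : (fun h : R => h^-1 *: (f (x + (c * (h *: 1 + 0)) *: v) - f (x + (c * 0) *: v))) =
    (fun h => h^-1 *: (f (h *: (c *: v) + x) - f x)).
  apply/funext => h; rewrite mulr0 scale0r !addr0 -mulr_algl scaler1 mulr1.
  by rewrite scalerA [x + _]addrC mulrC.
move=> [d1 d2]; split.
  by move: d1; rewrite /derivable /= E.
by move: d2; rewrite {1}/derive /= E => d2; rewrite /derive /= d2 mulrC.
Qed.

Lemma norm_line_lt (R : realType) (V : normedModType R) (a b : V) (h s r : R) :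
  `|h| * (`|a| + `|b|) < r -> `|s| <= 1 -> `|h *: b + (s * h) *: a| < r.
Proof.
move=> hr s1; apply: le_lt_trans hr; apply: le_trans (ler_normD _ _) _.
rewrite !normrZ mulrDr addrC lerD2r ler_wpM2r//.
by rewrite ler_piMl.
Qed.

(* Move first along b, then along a; the mean value theorem turns the second
   increment into a value of D_a f at a point tending to x. *)
Lemma is_deriveD_dir (R : realType) (V : normedModType R) (f : V -> R)
    (x a b : V) :
  (\forall z \near x, derivable f z a) -> {for x, continuous ('D_a f)} ->
  derivable f x b -> is_derive x (a + b) f ('D_a f x + 'D_b f x).
Proof.
move=> fa ca fb.
suff H : (fun h : R => h^-1 *: (f (h *: (a + b) + x) - f x)) @ 0^' --> 'D_a f x + 'D_b f x.
  split; first by apply/cvg_ex; exists ('D_a f x + 'D_b f x).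
  exact/cvg_lim.
have E : (fun h : R => h^-1 *: (f (h *: (a + b) + x) - f x)) =
  (fun h : R => h^-1 *: (f (h *: (a + b) + x) - f (h *: b + x)) +
     h^-1 *: (f (h *: b + x) - f x)).
  by apply/funext => h; rewrite -scalerDr addrA subrK.
rewrite E; apply: cvgD; last exact: fb.
apply/cvgrPdist_lt => e e0.
have := ca; move/cvgrPdist_lt => /(_ e e0) ca'.
have /nbhs_normP[r /= r0 Hr] : \forall z \near x, derivable f z a /\ `|'D_a f x - 'D_a f z| < e.
  by near do split.
have K0 : 0 < `|a| + `|b| + 1 by rewrite ltr_wpDl// addr_ge0.
near=> h.
have h0 : h != 0 by near: h; exact: nbhs_dnbhs_neq.
have hr : `|h| * (`|a| + `|b|) < r.
  have : `|h| < r / (`|a| + `|b| + 1).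
    near: h; apply: dnbhs0_lt; exact: divr_gt0.
  rewrite ltr_pdivlMr// => h1; apply: le_lt_trans h1.
  by rewrite ler_wpM2l// lerDl.
have inb (s : R) : `|s| <= 1 -> derivable f (h *: b + x + s *: (h *: a)) a /\
    `|'D_a f x - 'D_a f (h *: b + x + s *: (h *: a))| < e.
  move=> s1; apply: Hr => /=; rewrite distrC addrAC addrK scalerA.
  exact: norm_line_lt.
have dl (s : R) : `|s| <= 1 -> is_derive s 1 (fun t => f (h *: b + x + t *: (h *: a)))
    (h * 'D_a f (h *: b + x + s *: (h *: a))).
  move=> s1; have [d _] := inb s s1.
  have [d1 d2] := is_derive_scale_dir h d.
  by have := is_derive_line d1; rewrite d2.
have [c /itvP cI] : exists2 c, c \in `[0, 1] & f (h *: b + x + 1 *: (h *: a)) -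
    f (h *: b + x + 0 *: (h *: a)) = h * 'D_a f (h *: b + x + c *: (h *: a)) * (1 - 0).
  apply: (@MVT_segment R (fun t => f (h *: b + x + t *: (h *: a)))
    (fun s => h * 'D_a f (h *: b + x + s *: (h *: a)))); first exact: ler01.
    move=> s; rewrite in_itv/= => /andP[s0 s1]; apply: dl.
    by rewrite ger0_norm ltW.
  apply: derivable_within_continuous => s; rewrite in_itv/= => /andP[s0 s1].
  have [|d _] := dl s; last by [].
  by rewrite ger0_norm.
rewrite scale1r scale0r addr0 subr0 mulr1 => E1.
have -> : h *: (a + b) + x = h *: b + x + h *: a.
  by rewrite scalerDr -addrA addrC.
rewrite E1 -mulr_algl scaler1 mulrA mulVf// mul1r.
have [|_ ] := inb c; last by [].
by rewrite ger0_norm !cI.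
Unshelve. all: by end_near.
Qed.

Definition C1_on (R : realType) (n : nat) (D : set 'rV[R]_n)
    (f : 'rV[R]_n -> R) : Prop :=
  forall (i : 'I_n) x, D x ->
    derivable f x (delta_mx 0 i) /\ {for x, continuous (partial i f)}.

Definition C2_on (R : realType) (n : nat) (D : set 'rV[R]_n)
    (f : 'rV[R]_n -> R) : Prop :=
  C1_on D f /\ forall i : 'I_n, C1_on D (partial i f).

(** Coordinate directions are added one at a time. In [is_deriveD_dir] the new one plays the role of
    [a], whose derivative must exist nearby and be continuous; the part already summed is only known
    to have a derivative at [x]. *)
Lemma is_derive_C1_on (R : realType) (n : nat) (D : set 'rV[R]_n)
    (f : 'rV[R]_n -> R) (x y : 'rV[R]_n) : open D -> C1_on D f -> D x ->
  is_derive x y f (\sum_(i < n) y 0 i * partial i f x).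
Proof.
move=> oD fD Dx; rewrite [X in is_derive x X]row_sum_delta.
have nD : \forall z \near x, D z by exact: open_nbhs_nbhs.
elim: (index_enum _) => [|i s IH]; first by rewrite !big_nil; exact: is_derive0.
rewrite !big_cons.
have [d c] := fD i x Dx.
have nd : \forall z \near x, is_derive z (y 0 i *: delta_mx 0 i) f (y 0 i * partial i f z).
  by near=> z; apply: is_derive_scale_dir; apply: (fD i z _).1; near: z.
have Ex := nbhs_singleton nd.
have := @is_deriveD_dir R _ f x (y 0 i *: delta_mx 0 i) _ _ _ (@ex_derive _ _ _ _ _ _ _ IH).
rewrite (@derive_val _ _ _ _ _ _ _ IH) (@derive_val _ _ _ _ _ _ _ Ex); apply.
  by apply: filterS nd => z [].
rewrite /prop_for /continuous_at (@derive_val _ _ _ _ _ _ _ Ex).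
have : y 0 i * partial i f z @[z --> x] --> y 0 i * partial i f x.
  by apply: continuousM c; exact: cst_continuous.
apply: cvg_trans; apply: (@near_eq_cvg _ _ (nbhs x)).
by near=> z; apply/esym/derive_val; near: z.
Unshelve. all: by end_near.
Qed.

(** Two mean value theorems, one per direction, make the quotient a value of ['D_b ('D_a f)] at a
    point tending to [x]. The second difference itself is symmetric in [a] and [b], which is what
    [partialC] exploits. *)
Lemma second_difference_cvg (R : realType) (V : normedModType R) (f : V -> R)
    (x a b : V) :
  (\forall z \near x, derivable f z a /\ derivable ('D_a f) z b) ->
  {for x, continuous ('D_b ('D_a f))} ->
  h^-1 * (h^-1 * (f (x + h *: b + h *: a) - f (x + h *: a)
     - (f (x + h *: b) - f x))) @[h --> 0^'] --> 'D_b ('D_a f) x.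
Proof.
move=> fab cab; apply/cvgrPdist_lt => e e0.
have /cvgrPdist_lt /(_ e e0) ca' := cab.
have /nbhs_normP[r /= r0 Hr] : \forall z \near x,
    (derivable f z a /\ derivable ('D_a f) z b) /\
    `|'D_b ('D_a f) x - 'D_b ('D_a f) z| < e by near do split.
have K0 : 0 < `|a| + `|b| + 1 by rewrite ltr_wpDl// addr_ge0.
near=> h.
have h0 : h != 0 by near: h; exact: nbhs_dnbhs_neq.
have hr : `|h| * (`|a| + `|b|) < r.
  have : `|h| < r / (`|a| + `|b| + 1).
    near: h; apply: dnbhs0_lt; exact: divr_gt0.
  rewrite ltr_pdivlMr// => h1; apply: le_lt_trans h1.
  by rewrite ler_wpM2l// lerDl.
have inb (s t : R) : 0 <= s <= 1 -> 0 <= t <= 1 ->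
    (derivable f (x + t *: (h *: b) + s *: (h *: a)) a /\
     derivable ('D_a f) (x + t *: (h *: b) + s *: (h *: a)) b) /\
    `|'D_b ('D_a f) x - 'D_b ('D_a f) (x + t *: (h *: b) + s *: (h *: a))| < e.
  move=> /andP[s0 s1] /andP[t0 t1]; apply: Hr => /=.
  rewrite distrC -(addrA x) [x + _]addrC addrK.
  apply: le_lt_trans hr; apply: le_trans (ler_normD _ _) _.
  rewrite !normrZ mulrDr addrC (ger0_norm s0) (ger0_norm t0).
  by rewrite lerD// ler_piMl// mulr_ge0.
have da (s t : R) : 0 <= s <= 1 -> 0 <= t <= 1 ->
    is_derive s 1 (fun s => f (x + t *: (h *: b) + s *: (h *: a)))
    (h * 'D_a f (x + t *: (h *: b) + s *: (h *: a))).
  move=> s1 t1; have [[d _] _] := inb s t s1 t1.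
  have [d1 d2] := is_derive_scale_dir h d.
  by have := is_derive_line d1; rewrite d2.
have db (s t : R) : 0 <= s <= 1 -> 0 <= t <= 1 ->
    is_derive t 1 (fun t => 'D_a f (x + s *: (h *: a) + t *: (h *: b)))
    (h * 'D_b ('D_a f) (x + t *: (h *: b) + s *: (h *: a))).
  move=> s1 t1; have [[_ d] _] := inb s t s1 t1.
  rewrite addrAC in d *.
  have [d1 d2] := is_derive_scale_dir h d.
  by have := is_derive_line d1; rewrite d2.
have I0 : 0 <= (0 : R) <= 1 by rewrite lexx ler01.
have I1 : 0 <= (1 : R) <= 1 by rewrite lexx ler01.
(* [phi 1 - phi 0] is the second difference, and [dphi c] is [h] times an increment of ['D_a f]
   along [b], to which the mean value theorem applies again. *)
pose phi s := f (x + 1 *: (h *: b) + s *: (h *: a)) - f (x + 0 *: (h *: b) + s *: (h *: a)).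
pose dphi s := h * 'D_a f (x + 1 *: (h *: b) + s *: (h *: a)) -
   h * 'D_a f (x + 0 *: (h *: b) + s *: (h *: a)).
have dphiE (s : R) : 0 <= s <= 1 -> is_derive s 1 phi (dphi s).
  by move=> s1; apply: is_deriveB; apply: da.
have [c cI E1] : exists2 c, c \in `[0, 1] & phi 1 - phi 0 = dphi c * (1 - 0).
  apply: (MVT_segment ler01).
    by move=> s; rewrite in_itv/= => /andP[s0 s1]; apply: dphiE; rewrite !ltW.
  apply: derivable_within_continuous => s; rewrite in_itv/= => s01.
  by have [] := dphiE _ s01.
rewrite in_itv/= in cI.
pose psi t := 'D_a f (x + c *: (h *: a) + t *: (h *: b)).
pose dpsi t := h * 'D_b ('D_a f) (x + t *: (h *: b) + c *: (h *: a)).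
have dpsiE (t : R) : 0 <= t <= 1 -> is_derive t 1 psi (dpsi t) by exact: db.
have [d dI E2] : exists2 d, d \in `[0, 1] & psi 1 - psi 0 = dpsi d * (1 - 0).
  apply: (MVT_segment ler01).
    by move=> s; rewrite in_itv/= => /andP[s0 s1]; apply: dpsiE; rewrite !ltW.
  apply: derivable_within_continuous => s; rewrite in_itv/= => s01.
  by have [] := dpsiE _ s01.
rewrite in_itv/= in dI.
have -> : h^-1 * (h^-1 * (f (x + h *: b + h *: a) - f (x + h *: a)
     - (f (x + h *: b) - f x))) = 'D_b ('D_a f) (x + d *: (h *: b) + c *: (h *: a)).
  apply: (mulfI h0); rewrite (mulVKf h0).
  apply: (mulfI h0); rewrite (mulVKf h0).
  move: E1 E2; rewrite /phi /dphi /psi /dpsi !subr0 !mulr1 !scale0r !scale1r !addr0 => ->.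
  by rewrite -mulrBr !(addrAC _ (c *: _)) => ->.
by have [_ ] := inb c d cI dI.
Unshelve. all: by end_near.
Qed.

Lemma partialC (R : realType) (n : nat) (D : set 'rV[R]_n)
    (f : 'rV[R]_n -> R) (x : 'rV[R]_n) (i j : 'I_n) :
  open D -> C2_on D f -> D x ->
  partial j (partial i f) x = partial i (partial j f) x.
Proof.
move=> oD [fD pD] Dx.
have nD : \forall z \near x, D z by exact: open_nbhs_nbhs.
have H (k l : 'I_n) d :=
  @second_difference_cvg R _ f x (delta_mx 0 k) (delta_mx 0 l) d (pD k l x Dx).2.
have d (k l : 'I_n) : \forall z \near x, derivable f z (delta_mx 0 k) /\
    derivable (partial k f) z (delta_mx 0 l).
  by near=> z; split; [apply: (fD k z _).1|apply: (pD k l z _).1]; near: z.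
have h1 := H i j (d i j); have h2 := H j i (d j i).
apply: cvg_unique h1 _ => //.
apply: cvg_trans h2; apply: near_eq_cvg; near=> h.
by rewrite [x + _ + _]addrAC; congr (_ * (_ * _)); ring.
Unshelve. all: by end_near.
Qed.

(** The last hypothesis holds at a minimum as well as for a convex function, and both cases are
    used. If [q < 0], then [g' t < g' 0 < g' (- t)] for small [t > 0], and [g t + g (- t)] would
    decrease strictly. *)
Lemma ge0_second_derivative (R : realType) (g g' : R -> R) (q d : R) :
  0 < d -> (forall t : R, `|t| < d -> is_derive t 1 g (g' t)) ->
  is_derive (0 : R) 1 g' q ->
  (forall t, `|t| < d -> 2 * g 0 <= g t + g (- t)) -> 0 <= q.
Proof.
move=> d0 gg' [qd qE] gmin; rewrite leNgt; apply/negP => q0.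
have : (fun h : R => h^-1 *: (g' (h *: 1 + 0) - g' 0)) @ 0^' --> q by rewrite -qE.
move=> /cvgr_lt /(_ _ q0) [r /= r0 Hr].
have lt_g' (t : R) : t != 0 -> `|t| < r -> t^-1 * (g' t - g' 0) < 0.
  move=> t0 tr; have := Hr t; rewrite /= sub0r normrN => /(_ tr t0).
  by rewrite -mulr_algl scaler1 addr0 -mulr_algl scaler1 mulr1.
pose t := Num.min r d / 2.
have t0 : 0 < t by rewrite divr_gt0// lt_min r0.
have trd : t < Num.min r d by rewrite /t ltr_pdivrMr// ltr_pMr ?lt_min ?r0// ltr1n.
move: trd; rewrite lt_min => /andP[tr td].
have kd (s : R) : `|s| < d -> is_derive s 1 (fun s => g s + g (- s)) (g' s - g' (- s)).
  move=> sd; apply: is_deriveD; first exact: gg'.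
  rewrite -mulrN1; apply: is_derive1_comp; apply: gg'.
  by rewrite normrN.
have [c cI E] : exists2 c, c \in `]0, t[ &
    (g t + g (- t)) - (g 0 + g (- 0)) = (g' c - g' (- c)) * (t - 0).
  apply: (@MVT _ (fun s => g s + g (- s)) (fun c => g' c - g' (- c)) _ _ t0).
    move=> s; rewrite in_itv/= => /andP[s0 s1]; apply: kd.
    by rewrite gtr0_norm// (lt_trans s1).
  apply: derivable_within_continuous => s; rewrite in_itv/= => /andP[s0 s1].
  have [|] := kd s; last by [].
  by rewrite ger0_norm// (le_lt_trans s1).
move: cI; rewrite in_itv/= => /andP[c0 ct].
have cr : c < r by exact: lt_trans tr.
have h1 : g' c < g' 0.
  have := lt_g' c (lt0r_neq0 c0); rewrite gtr0_norm// => /(_ cr).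
  by rewrite pmulr_rlt0 ?invr_gt0// subr_lt0.
have h2 : g' 0 < g' (- c).
  have := lt_g' (- c); rewrite oppr_eq0 normrN gtr0_norm// lt0r_neq0// => /(_ isT cr).
  by rewrite nmulr_rlt0 ?invr_lt0 ?oppr_lt0// subr_gt0.
have : (g' c - g' (- c)) * (t - 0) < 0.
  by rewrite subr0 pmulr_llt0// subr_lt0 (lt_trans h1).
rewrite -E oppr0 -mulr2n subr_lt0 ltNge -mulr_natl gmin//.
by rewrite gtr0_norm.
Qed.

Definition quad (R : realType) (n : nat) (A : 'M[R]_n) (y : 'rV[R]_n) : R :=
  (y *m A *m y^T) 0 0.

Lemma is_derive_line2 (R : realType) (n : nat) (D : set 'rV[R]_n)
    (f : 'rV[R]_n -> R) (x y : 'rV[R]_n) : open D -> C2_on D f ->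
  forall s, D (x + s *: y) ->
  is_derive s 1 (fun t => f (x + t *: y)) ('D_y f (x + s *: y)) /\
  is_derive s 1 (fun t => 'D_y f (x + t *: y)) (quad (hessian f (x + s *: y)) y).
Proof.
move=> oD [fD pD] s Ds.
split; first by apply: is_derive_line; have [] := is_derive_C1_on y oD fD Ds.
have nD : \forall z \near (x + s *: y), D z by exact: open_nbhs_nbhs.
have h : is_derive (x + s *: y) y ('D_y f) (quad (hessian f (x + s *: y)) y).
  apply: (@near_eq_is_derive _ _ _ (\sum_(i < n) (y 0 i \*: partial i f))).
    near=> z; have Dz : D z by near: z.
    by rewrite (@derive_val _ _ _ _ _ _ _ (is_derive_C1_on y oD fD Dz)) fct_sumE.
  have -> : quad (hessian f (x + s *: y)) y =
    \sum_(i < n) (y 0 i *: \sum_(j < n) y 0 j * partial j (partial i f) (x + s *: y)).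
    rewrite /quad mxE.
    under eq_bigr => j _ do rewrite !mxE big_distrl /=.
    rewrite exchange_big; apply: eq_bigr => i _.
    rewrite scaler_sumr; apply: eq_bigr => j _.
    by rewrite !mxE -mulr_algl scaler1; ring.
  apply: is_derive_sum => i; apply: is_deriveZ.
  exact: is_derive_C1_on oD (pD i) Ds.
have [h1 h2] := h; rewrite -h2; exact: is_derive_line.
Unshelve. all: by end_near.
Qed.

(** * Monotonicity of the determinant *)

Lemma quad_block (R : realType) (n : nat) (a t : R) (u v : 'rV[R]_n) (D : 'M[R]_n) :
  quad (block_mx a%:M u u^T D) (row_mx t%:M v) =
  a * t ^+ 2 + 2 * t * (u *m v^T) 0 0 + quad D v.
Proof.
rewrite /quad mul_row_block tr_row_mx mul_row_col !mulmxDl.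
have -> : v *m u^T = (u *m v^T)^T by rewrite trmx_mul trmxK.
rewrite tr_scalar_mx -!scalar_mxM mul_mx_scalar mul_scalar_mx -scalemxAl.
by rewrite !mxE !eqxx !mulr1n; ring.
Qed.

Lemma det_schur (R : realType) (n : nat) (a : R) (u : 'rV[R]_n) (D : 'M[R]_n) :
  a != 0 ->
  \det (block_mx a%:M u u^T D) = a * \det (D - a^-1 *: (u^T *m u)).
Proof.
move=> a0.
have -> : block_mx a%:M u u^T D =
    block_mx 1%:M 0 (a^-1 *: u^T) 1%:M *m block_mx a%:M u 0 (D - a^-1 *: (u^T *m u)).
  rewrite mulmx_block !mul1mx !mul0mx !addr0 mul_mx_scalar scalerA.
  by rewrite mulfV// scale1r -scalemxAl addrCA subrr addr0.
by rewrite det_mulmx det_lblock !det1 !mul1r det_ublock det_scalar1.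
Qed.

Lemma quad_schur (R : realType) (n : nat) (a : R) (u v : 'rV[R]_n) (D : 'M[R]_n) :
  quad (D - a^-1 *: (u^T *m u)) v = quad D v - a^-1 * (u *m v^T) 0 0 ^+ 2.
Proof.
rewrite /quad mulmxBr mulmxBl -scalemxAr -scalemxAl !mulmxA.
have -> : v *m u^T = (u *m v^T)^T by rewrite trmx_mul trmxK.
rewrite -(mulmxA _ u); move: (u *m v^T) => w.
by rewrite [w in LHS]mx11_scalar tr_scalar_mx -scalar_mxM !mxE mulr1n expr2.
Qed.

(* Induction through the Schur complement S_A of the corner a: the form of S_A
   is the partial minimum v |-> min_t quad A (t, v), hence monotone in A. *)
Lemma det_pos_def_le (R : realType) (n : nat) (A B : 'M[R]_n) :
  A^T = A -> B^T = B -> (forall y, y != 0 -> 0 < quad A y) ->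
  (forall y, quad A y <= quad B y) -> 0 < \det A <= \det B.
Proof.
elim: n A B => [A B _ _ _ _|n IH]; first by rewrite !det_mx00 ltr01 lexx.
rewrite -[n.+1]/(1 + n)%N => A B At Bt Apos AB.
have S (M : 'M[R]_(1 + n)) : M^T = M ->
    exists (a : R) (u : 'rV[R]_n) D, M = block_mx a%:M u u^T D /\ D^T = D.
  move=> Mt; exists (ulsubmx M 0 0), (ursubmx M), (drsubmx M).
  split; first by rewrite -mx11_scalar trmx_ursub Mt submxK.
  by rewrite trmx_drsub Mt.
have [a [u [D [EA Dt]]]] := S A At.
have [b [v [F [EB Ft]]]] := S B Bt.
have a0 : 0 < a.
  have /Apos : row_mx 1%:M (0 : 'rV[R]_n) != 0.
    apply/eqP => /rowP/(_ (lshift _ 0)); rewrite row_mxEl !mxE => /eqP.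
    by rewrite oner_eq0.
  by rewrite EA quad_block /quad trmx0 !mulmx0 mxE; nra.
have ab : a <= b.
  have := AB (row_mx 1%:M (0 : 'rV[R]_n)).
  by rewrite EA EB !quad_block /quad trmx0 !mulmx0 mxE; nra.
have b0 := lt_le_trans a0 ab.
rewrite EA EB !det_schur ?lt0r_neq0//.
have sym (x : R) (w : 'rV[R]_n) (G : 'M[R]_n) : G^T = G ->
    (G - x *: (w^T *m w))^T = G - x *: (w^T *m w).
  by move=> Gt; rewrite linearB linearZ /= trmx_mul trmxK Gt.
have /andP[p q] : 0 < \det (D - a^-1 *: (u^T *m u)) <= \det (F - b^-1 *: (v^T *m v)).
  apply: IH; [exact: sym|exact: sym| |] => y.
    move=> y0; have /Apos : row_mx (- (a^-1 * (u *m y^T) 0 0))%:M y != 0.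
      apply: contraNneq y0 => /(congr1 rsubmx); rewrite row_mxKr => ->.
      by rewrite linear0.
    rewrite EA quad_block quad_schur; congr (_ < _).
    by field; rewrite lt0r_neq0.
  (* The minimiser of [quad B] over the first coordinate: there [quad B] equals the form of its
     Schur complement, while [quad A] is at least its own minimum. *)
  set t := - (b^-1 * (v *m y^T) 0 0).
  have := AB (row_mx t%:M y); rewrite EA EB !quad_block !quad_schur.
  have -> : b * t ^+ 2 + 2 * t * (v *m y^T) 0 0 + quad F y =
    quad F y - b^-1 * (v *m y^T) 0 0 ^+ 2 by rewrite /t; field; rewrite lt0r_neq0.
  apply: le_trans; rewrite addrC lerD2r.
  have -> : a * t ^+ 2 + 2 * t * (u *m y^T) 0 0 =
    a * (t + a^-1 * (u *m y^T) 0 0) ^+ 2 - a^-1 * (u *m y^T) 0 0 ^+ 2.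
    by field; rewrite lt0r_neq0.
  by rewrite lerDr mulr_ge0 ?sqr_ge0// ltW.
by rewrite mulr_gt0//= ler_pM// ltW.
Qed.

Lemma quadD (R : realType) (n : nat) (A : 'M[R]_n) (x y : 'rV[R]_n) (t : R) :
  A^T = A ->
  quad A (x + t *: y) = quad A x + 2 * t * (x *m A *m y^T) 0 0 + t ^+ 2 * quad A y.
Proof.
move=> At; rewrite /quad linearD linearZ /= !(mulmxDl, mulmxDr).
rewrite -!(scalemxAl, scalemxAr).
have -> : y *m A *m x^T = (x *m A *m y^T)^T by rewrite !trmx_mul trmxK At mulmxA.
by rewrite !mxE; ring.
Qed.

(* A nonnegative form vanishing at y is minimal there, so y lies in its kernel. *)
Lemma quad_gt0_det (R : realType) (n : nat) (A : 'M[R]_n) :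
  A^T = A -> \det A != 0 -> (forall y, 0 <= quad A y) ->
  forall y, y != 0 -> 0 < quad A y.
Proof.
move=> At detA A0 y y0; rewrite lt_neqAle A0 andbT; apply/negP => /eqP/esym Ay.
have kerA (z : 'rV[R]_n) : (y *m A *m z^T) 0 0 = 0.
  set b := (y *m A *m z^T) 0 0; set c := quad A z.
  have H (t : R) : 0 <= 2 * t * b + t ^+ 2 * c.
    by have := A0 (y + t *: z); rewrite quadD// Ay add0r.
  have c0 : 0 <= c by exact: A0.
  apply/eqP; rewrite -sqrf_eq0 eq_le sqr_ge0 andbT.
  have c1 : 0 < c + 1 by rewrite ltr_wpDl.
  (* The natural test value [- b / c] fails for [c = 0]; with [c + 1] the result is still a negative
     multiple of [b ^+ 2]. *)
  have := H (- (b / (c + 1))); rewrite -(pmulr_lge0 _ (exprn_gt0 2 c1)) .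
  have -> : (2 * - (b / (c + 1)) * b + (- (b / (c + 1))) ^+ 2 * c) * (c + 1) ^+ 2 =
    - (b ^+ 2 * (c + 2)) by field; rewrite lt0r_neq0.
  by rewrite oppr_ge0 pmulr_lle0// ltr_wpDl.
move/eqP: detA; apply; apply/eqP/det0P; exists y => //.
apply/rowP => j; have := kerA (delta_mx 0 j).
by rewrite trmx_delta -colE !mxE.
Qed.

Lemma quadZ (R : realType) (n : nat) (A : 'M[R]_n) (y : 'rV[R]_n) (c : R) :
  quad (c *: A) y = c * quad A y.
Proof. by rewrite /quad -scalemxAr -scalemxAl mxE. Qed.

(** * The comparison principle on the unit ball *)

(** Being a polynomial, it is differentiable at the centre, where [enorm] is not. *)
Definition sqnorm (R : realType) (n : nat) (x : 'rV[R]_n) : R :=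
  \sum_(i < n) x 0 i ^+ 2.

Lemma sqnorm_ge0 (R : realType) (n : nat) (x : 'rV[R]_n) : 0 <= sqnorm x.
Proof. by apply: sumr_ge0 => i _; exact: sqr_ge0. Qed.

Lemma enorm_ge0 (R : realType) (n : nat) (x : 'rV[R]_n) : 0 <= enorm x.
Proof. exact: sqrtr_ge0. Qed.

Lemma sqr_enorm (R : realType) (n : nat) (x : 'rV[R]_n) : enorm x ^+ 2 = sqnorm x.
Proof. by rewrite sqr_sqrtr// sqnorm_ge0. Qed.

Lemma unit_ballE (R : realType) (n : nat) :
  @unit_ball R n = [set x | sqnorm x < 1].
Proof.
by apply/seteqP; split => x; rewrite /unit_ball /= -sqr_enorm expr_lt1 ?enorm_ge0.
Qed.

Lemma sqr_coord_le_sqnorm (R : realType) (n : nat) (x : 'rV[R]_n) (i : 'I_n) :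
  x 0 i ^+ 2 <= sqnorm x.
Proof.
by rewrite /sqnorm (bigD1 i)//= lerDl; apply: sumr_ge0 => j _; exact: sqr_ge0.
Qed.

Lemma sqnormZ (R : realType) (n : nat) (x : 'rV[R]_n) (c : R) :
  sqnorm (c *: x) = c ^+ 2 * sqnorm x.
Proof. by rewrite /sqnorm mulr_sumr; apply: eq_bigr => i _; rewrite mxE exprMn. Qed.

Lemma sqnorm_continuous (R : realType) (n : nat) : continuous (@sqnorm R n).
Proof.
move=> x.
suff H (s : seq 'I_n) : {for x, continuous (fun x : 'rV[R]_n => \sum_(i <- s) x 0 i ^+ 2)}.
  exact: H.
elim: s => [|i s IH].
  have -> : (fun x : 'rV[R]_n => \sum_(i <- [::]) x 0 i ^+ 2) = cst 0.
    by apply/funext => y; rewrite big_nil.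
  exact: cst_continuous.
have -> : (fun x : 'rV[R]_n => \sum_(i <- i :: s) x 0 i ^+ 2) =
    (fun x => x 0 i * x 0 i) \+ (fun x => \sum_(i <- s) x 0 i ^+ 2).
  by apply/funext => y; rewrite big_cons expr2.
by apply: continuousD IH; apply: continuousM; exact: coord_continuous.
Qed.

Lemma open_unit_ball (R : realType) (n : nat) : open (@unit_ball R n).
Proof.
rewrite unit_ballE; apply: (@open_comp _ _ (@sqnorm R n) [set y | y < 1]).
  by move=> x _; exact: sqnorm_continuous.
exact: open_lt.
Qed.

Lemma closure_unit_ball (R : realType) (n : nat) (x : 'rV[R]_n) :
  closure (@unit_ball R n) x -> sqnorm x <= 1.
Proof.
have cl : closed [set x : 'rV[R]_n | sqnorm x <= 1].
  apply: (@closed_comp _ _ (@sqnorm R n) [set y | y <= 1]).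
    by move=> y _; exact: sqnorm_continuous.
  exact: closed_le.
move=> h; apply: cl; apply: closureS h.
by rewrite unit_ballE => y /= /ltW.
Qed.

Lemma compact_closure_unit_ball (R : realType) (n : nat) :
  compact (closure (@unit_ball R n)).
Proof.
have co : compact [set v : 'rV[R]_n | forall i, v ord0 i \in `[(- 1), 1]].
  apply: (@rV_compact _  _ (fun=> `[(- 1 : R), 1]%classic)).
  by move=> _; exact: segment_compact.
apply: subclosed_compact (@closed_closure _ _) co _.
move=> x /closure_unit_ball x1 i; rewrite in_itv/= -ler_norml.
rewrite -(@expr_le1 _ 2)// -normrX ger0_norm ?sqr_ge0//.
exact: le_trans (sqr_coord_le_sqnorm _ _) x1.
Qed.

Lemma closure_unit_ballP (R : realType) (n : nat) (x : 'rV[R]_n) :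
  closure (@unit_ball R n) x -> unit_ball x \/ frontier (@unit_ball R n) x.
Proof.
move=> cx; have [bx|nbx] := pselect (unit_ball x); [by left|right; split => //].
by move=> /interior_subset.
Qed.

Lemma frontier_unit_ball (R : realType) (n : nat) (x : 'rV[R]_n) :
  frontier (@unit_ball R n) x -> sqnorm x = 1.
Proof.
move=> [cx nx]; apply/eqP; rewrite eq_le closure_unit_ball// leNgt.
apply/negP => x1; apply: nx.
rewrite (interior_id _).1; first by rewrite unit_ballE.
exact: open_unit_ball.
Qed.

Lemma C2_on_C2_closure (R : realType) (n : nat) (D : set 'rV[R]_n)
    (u : 'rV[R]_n -> R) : open D -> C2_closure D u -> C2_on D u.
Proof.
move=> oD [_ d1 d2 e1 e2].
have H f x : extends_to_closure D f -> D x -> {for x, continuous f}.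
  move=> [g [gc gf]] Dx.
  have gx : {for x, continuous g}.
    have := continuous_subspaceW (@subset_closure _ D) gc.
    by rewrite continuous_open_subspace// => /(_ x); apply; rewrite inE.
  have nD : \forall z \near x, D z by exact: open_nbhs_nbhs.
  rewrite /prop_for /continuous_at -gf//; apply: cvg_trans gx.
  by apply: (@near_eq_cvg _ _ (nbhs x)); near=> z; apply: gf; near: z.
split => [i x Dx|i j x Dx]; split; [exact: d1|exact: H|exact: d2|exact: H].
Unshelve. all: by end_near.
Qed.

Lemma unit_ball_segment (R : realType) (n : nat) (x y : 'rV[R]_n) :
  unit_ball x -> exists2 d : R, 0 < d & forall t, `|t| < d -> unit_ball (x + t *: y).
Proof.
move=> Dx.
have c : {for (0 : R), continuous (fun t : R => x + t *: y)}.
  apply: continuousD; first exact: cst_continuous.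
  exact: scalel_continuous.
have : \forall t \near (0 : R), unit_ball (x + t *: y).
  apply: c; rewrite scale0r addr0; apply: open_nbhs_nbhs; split => //.
  exact: open_unit_ball.
move=> [d /= d0 H]; exists d => // t td; apply: H => /=.
by rewrite sub0r normrN.
Qed.

Lemma quad_hessian_ge0 (R : realType) (n : nat) (v : 'rV[R]_n -> R) (x y : 'rV[R]_n) :
  C2_on (@unit_ball R n) v -> strictly_convex_on (@unit_ball R n) v ->
  unit_ball x -> 0 <= quad (hessian v x) y.
Proof.
move=> v2 vc Dx; have [d d0 H] := unit_ball_segment y Dx.
have L (s : R) (sd : `|s| < d) := is_derive_line2 (@open_unit_ball R n) v2 (H s sd).
apply: (@ge0_second_derivative _ (fun t => v (x + t *: y)) (fun t => 'D_y v (x + t *: y)) _ d d0).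
- by move=> t td; exact: (L t td).1.
- have := (L 0 _).2; rewrite normr0 => /(_ d0).
  by rewrite scale0r addr0.
- move=> t td; rewrite scale0r addr0.
  (* Strict convexity concerns distinct points only, so [t = 0] or [y = 0] is settled by
     equality. *)
  have [e|yt0] := eqVneq (t *: y) 0.
    by rewrite scaleNr e oppr0 addr0 mulr_natl.
  have := vc (x + t *: y) (x + (- t) *: y) 2^-1.
  have -> : 2^-1 *: (x + t *: y) + (1 - 2^-1) *: (x + (- t) *: y) = x.
    by apply/rowP => i; rewrite !mxE; field.
  have h : 1 - 2^-1 = 2^-1 :> R by field.
rewrite h -mulrDr => /(_ (H t td)) {}h.
  have := h (H (- t) _); rewrite normrN => /(_ td) {}h.
  apply/ltW; rewrite -ltr_pdivlMl//; apply: h.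
  + rewrite (inj_eq (addrI x)) scaleNr -addr_eq0 -mulr2n -scaler_nat scaler_eq0 negb_or yt0 andbT.
    by rewrite pnatr_eq0.
  + by rewrite invr_gt0.
  + by rewrite invf_lt1// ltr1n.
Qed.

Lemma hessian_sym (R : realType) (n : nat) (D : set 'rV[R]_n)
    (f : 'rV[R]_n -> R) (x : 'rV[R]_n) : open D -> C2_on D f -> D x ->
  (hessian f x)^T = hessian f x.
Proof.
by move=> oD fD Dx; apply/matrixP => i j; rewrite !mxE; exact: partialC oD fD Dx.
Qed.

Lemma hessian_at_max (R : realType) (n : nat) (D : set 'rV[R]_n)
    (u v : 'rV[R]_n -> R) (c : R) (x y : 'rV[R]_n) (d : R) : open D ->
  C2_on D u -> C2_on D v -> 0 < d -> (forall t, `|t| < d -> D (x + t *: y)) ->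
  (forall z, D z -> c * v z - u z <= c * v x - u x) ->
  c * quad (hessian v x) y <= quad (hessian u x) y.
Proof.
move=> oD u2 v2 d0 H xmax; rewrite -subr_ge0.
have Lu (s : R) (sd : `|s| < d) := is_derive_line2 oD u2 (H s sd).
have Lv (s : R) (sd : `|s| < d) := is_derive_line2 oD v2 (H s sd).
apply: (@ge0_second_derivative _ (fun t => u (x + t *: y) - c * v (x + t *: y))
  (fun t => 'D_y u (x + t *: y) - c * 'D_y v (x + t *: y)) _ d d0).
- move=> t td; apply: is_deriveB; first exact: (Lu t td).1.
  by apply: is_deriveZ; exact: (Lv t td).1.
- have := (Lu 0 _).2; have := (Lv 0 _).2; rewrite normr0 => /(_ d0) h1 /(_ d0) h2.
  rewrite scale0r addr0 in h1 h2.
  exact: is_deriveB h2 (@is_deriveZ _ _ _ _ c _ _ _ h1).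
- move=> t td; rewrite scale0r addr0.
  have := xmax _ (H t td); have := xmax (x + (- t) *: y) (H _ _).
  by rewrite normrN => /(_ td); lra.
Qed.

(* At an interior maximum of (1 + e) v - u one has (1 + e) D^2 v <= D^2 u, so
   det D^2 u >= (1 + e)^n det D^2 v > det D^2 v. *)
Lemma comparison (R : realType) (n : nat) (u v : 'rV[R]_n -> R) : (0 < n)%N ->
  C2_closure (@unit_ball R n) u -> C2_closure (@unit_ball R n) v ->
  strictly_convex_on (@unit_ball R n) v ->
  (forall x, unit_ball x -> v x < 0) ->
  (forall x, frontier (@unit_ball R n) x -> u x = 0 /\ v x = 0) ->
  (forall x, unit_ball x -> 0 < \det (hessian v x)) ->
  (forall x, unit_ball x -> \det (hessian u x) <= \det (hessian v x)) ->
  forall x, unit_ball x -> v x <= u x.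
Proof.
move=> n0 uC vC vc v0 uv0 detv detuv x0 Dx0; rewrite leNgt; apply/negP => uv.
have oD := @open_unit_ball R n.
have u2 := C2_on_C2_closure oD uC; have v2 := C2_on_C2_closure oD vC.
(* With this [e], [(1 + e) v - u] is still positive at [x0], being half of [v x0 - u x0]. *)
pose e := (v x0 - u x0) / (- (2 * v x0)).
have e0 : 0 < e by rewrite divr_gt0 ?subr_gt0// oppr_gt0 pmulr_rlt0// v0.
pose w x := (1 + e) * v x - u x.
have w0 : 0 < w x0.
  have -> : w x0 = (v x0 - u x0) / 2.
    by rewrite /w /e; field; rewrite lt_eqF ?v0.
  by rewrite divr_gt0// subr_gt0.
have wc : {within closure (@unit_ball R n), continuous w}.
  case: uC => uc _ _ _ _; case: vC => vc' _ _ _ _.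
  apply/subspace_continuousP => x cx.
  move/subspace_continuousP : uc => /(_ x cx) uc.
  move/subspace_continuousP : vc' => /(_ x cx) vc'.
  by apply: cvgB uc; apply: cvgM vc'; exact: cvg_cst.
have [c cD cmax] := EVT_max_rV (ex_intro _ x0 (@subset_closure _ _ _ Dx0))
  (@compact_closure_unit_ball R n) wc.
rewrite inE in cD.
have Dc : unit_ball c.
  have [//|/uv0[uc vc0]] := closure_unit_ballP cD.
  have := cmax x0; rewrite inE => /(_ (@subset_closure _ _ _ Dx0)).
  by rewrite leNgt /w uc vc0 mulr0 subr0 w0.
have AB y : quad ((1 + e) *: hessian v c) y <= quad (hessian u c) y.
  have [d d0 H] := unit_ball_segment y Dc.
  rewrite quadZ; apply: (hessian_at_max oD u2 v2 d0 H) => z Dz.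
  by have := cmax z; rewrite inE => /(_ (@subset_closure _ _ _ Dz)).
have Hv := hessian_sym oD v2 Dc; have Hu := hessian_sym oD u2 Dc.
have /andP[_] : 0 < \det ((1 + e) *: hessian v c) <= \det (hessian u c).
  apply: det_pos_def_le => //; first by rewrite linearZ /= Hv.
  move=> y y0; rewrite quadZ mulr_gt0 ?addr_gt0//.
  apply: (quad_gt0_det Hv _ _ y0) => [|z]; first exact: lt0r_neq0 (detv _ Dc).
  exact: quad_hessian_ge0.
rewrite detZ leNgt => /negP; apply.
apply: le_lt_trans (detuv _ Dc) _.
rewrite ltr_pMl; last exact: detv.
by rewrite expr_gt1// ?ltrDl// addr_ge0// ltW.
Qed.

(** * Radial functions *)

Lemma is_derive_of_line (R : realType) (V : normedModType R) (f : V -> R)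
    (x v : V) (l : R) :
  is_derive (0 : R) 1 (fun t => f (x + t *: v)) l -> is_derive x v f l.
Proof.
have E : (fun h : R => h^-1 *: (f (x + (h *: (1 : R) + 0) *: v) - f (x + (0 : R) *: v))) =
    (fun h => h^-1 *: (f (h *: v + x) - f x)).
  by apply/funext => h; rewrite [h *: 1]mulr1 scale0r !addr0 [x + _]addrC.
move=> [d1 d2]; split; first by move: d1; rewrite /derivable /= E.
by move: d2; rewrite {1}/derive /= E.
Qed.

Lemma is_derive_comp1 (R : realType) (V : normedModType R) (f : V -> R)
    (g : R -> R) (x v : V) (a b : R) :
  is_derive (f x) 1 g a -> is_derive x v f b -> is_derive x v (g \o f) (a * b).
Proof.
move=> dg [df dfE]; apply: is_derive_of_line.
have := @is_derive_line _ _ f x v (0 : R); rewrite scale0r addr0 dfE => /(_ df) h.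
apply: (is_derive1_comp (f := g) (g := fun t => f (x + t *: v))) h.
by rewrite scale0r addr0.
Qed.

Lemma is_derive_coord (R : realType) (n : nat) (x v : 'rV[R]_n) (i : 'I_n) :
  is_derive x v (fun x => x 0 i) (v 0 i).
Proof.
apply: is_derive_of_line.
have -> : (fun t : R => (x + t *: v) 0 i) = (cst (x 0 i) + (v 0 i) \*: @id R).
  apply/funext => t; rewrite !mxE /=.
  by rewrite /GRing.scale /= mulrC.
have := is_deriveD (is_derive_cst (x 0 i) (0 : R) 1)
  (is_deriveZ (f := @id R) (v 0 i) (is_derive_id (0 : R) 1)).
by rewrite add0r scaler1.
Qed.

Lemma is_derive_sqnorm (R : realType) (n : nat) (x : 'rV[R]_n) (i : 'I_n) :
  is_derive x (delta_mx 0 i) (@sqnorm R n) (2 * x 0 i).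
Proof.
have -> : @sqnorm R n = \sum_(k < n) (fun x : 'rV[R]_n => x 0 k) ^+ 2.
  by apply/funext => y; rewrite fct_sumE.
have -> : 2 * x 0 i = \sum_(k < n) (2 * x 0 k ^+ 1) *: (delta_mx 0 i : 'rV[R]_n) 0 k.
  rewrite (bigD1 i)//= big1 => [|k ki]; rewrite !mxE eqxx ?eqxx /=.
    by rewrite expr1 scaler1 addr0.
  by rewrite (negbTE ki) scaler0.
apply: is_derive_sum => k.
by have := is_deriveX 2 (is_derive_coord x (delta_mx 0 i) k).
Qed.

(* In the variable s = |x|^2 the Hessian of Phi (|x|^2) is
   A I + (q / s) x^T x, and x / 0 = 0 makes this correct at the centre too. *)
Definition radial_profile (R : realType) (Phi A q : R -> R) : Prop :=
  [/\ continuous Phi, continuous A, continuous q, q 0 = 0 &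
   [/\ exists K : R, forall s, 0 <= s < 1 -> `|Phi s - Phi 0| <= K * s,
      forall s : R, 0 < s < 1 -> is_derive s 1 Phi (A s / 2) &
      forall s : R, 0 < s < 1 -> is_derive s 1 A (q s / s / 2)]].

Section Radial.
Context (R : realType) (n : nat) (Phi A q : R -> R).
Context (prof : radial_profile Phi A q).

Let u : 'rV[R]_n -> R := fun x => Phi (sqnorm x).

Lemma unit_ball_sqnorm (x : 'rV[R]_n) : unit_ball x -> 0 <= sqnorm x < 1.
Proof. by rewrite unit_ballE sqnorm_ge0. Qed.

Lemma sqnorm_eq0 (x : 'rV[R]_n) : sqnorm x = 0 -> x = 0.
Proof.
move=> /eqP; rewrite psumr_eq0 => [|i _]; last exact: sqr_ge0.
move=> /allP H; apply/rowP => i; rewrite mxE; apply/eqP.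
by rewrite -sqrf_eq0; apply: H; rewrite mem_index_enum.
Qed.

(** Away from the centre this is the chain rule. At the centre [Phi] has no assumed derivative;
    along a coordinate line [s = h^2], so the bound [K * s] alone makes the derivative vanish. *)
Lemma radial_partial (i : 'I_n) (x : 'rV[R]_n) : unit_ball x ->
  is_derive x (delta_mx 0 i) u (x 0 i * A (sqnorm x)).
Proof.
move=> /unit_ball_sqnorm xD; have [_ _ _ _ [[K PhiK] dPhi _]] := prof.
have [s0|s0] := eqVneq (sqnorm x) 0; last first.
  have sD : 0 < sqnorm x < 1.
    by case/andP : xD => x0 x1; rewrite lt_neqAle eq_sym s0 x0.
  have := is_derive_comp1 (dPhi _ sD) (is_derive_sqnorm x i).
  by congr is_derive; field.
rewrite (sqnorm_eq0 s0) mxE mul0r; apply: is_derive_of_line.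
have z0 : sqnorm (0 : 'rV[R]_n) = 0 by rewrite -(sqnorm_eq0 s0).
have e1 : sqnorm (delta_mx 0 i : 'rV[R]_n) = 1.
  rewrite /sqnorm (bigD1 i)//= mxE !eqxx expr1n big1 ?addr0// => j ji.
  by rewrite mxE (negbTE ji) andbF expr0n.
have L : (fun h : R => h^-1 *: (u (0 + (h *: (1 : R) + 0) *: delta_mx 0 i) -
    u (0 + (0 : R) *: delta_mx 0 i))) @ 0^' --> (0 : R).
  apply/cvgrPdist_lt => e e0.
  have K0 : 0 < `|K| + 1 by rewrite ltr_wpDl.
  near=> h.
  have h0 : h != 0 by near: h; exact: nbhs_dnbhs_neq.
  have hp : 0 < `|h| by rewrite normr_gt0.
  have h1 : `|h| < 1 by near: h; exact: dnbhs0_lt.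
  have he : `|h| < e / (`|K| + 1) by near: h; apply: dnbhs0_lt; rewrite divr_gt0.
  rewrite sub0r normrN !addr0 scale0r [h *: 1]mulr1 !add0r /u sqnormZ e1 mulr1 z0.
  rewrite normrZ normfV ltr_pdivrMl//.
  have h2 : 0 <= h ^+ 2 < 1 by rewrite sqr_ge0 -real_normK ?num_real// expr_lt1.
  apply: le_lt_trans (PhiK _ h2) _.
  apply: (@le_lt_trans _ _ (`|K| * h ^+ 2)); first by rewrite ler_wpM2r ?sqr_ge0// ler_norm.
  rewrite -real_normK ?num_real// expr2 mulrCA ltr_pM2l//.
  apply: le_lt_trans (_ : (`|K| + 1) * `|h| < e); first by rewrite ler_wpM2r// lerDl.
  by rewrite mulrC -ltr_pdivlMr.
by split; [apply/cvg_ex; exists 0|exact/cvg_lim].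
Unshelve. all: by end_near.
Qed.

(** At the centre the difference quotient is exactly [(i == j)%:R * A (h^2)], so continuity of [A]
    suffices there. *)
Lemma radial_partial2 (i j : 'I_n) (x : 'rV[R]_n) : unit_ball x ->
  is_derive x (delta_mx 0 j) (fun x => x 0 i * A (sqnorm x))
    ((i == j)%:R * A (sqnorm x) + q (sqnorm x) / sqnorm x * (x 0 i * x 0 j)).
Proof.
move=> /unit_ball_sqnorm /andP[x0 x1]; have [_ cA _ q0 [_ _ dA]] := prof.
have [s0|s0] := eqVneq (sqnorm x) 0.
  have -> : x = 0 by exact: sqnorm_eq0.
  have -> : sqnorm (0 : 'rV[R]_n) = 0 by rewrite /sqnorm big1// => k _; rewrite mxE expr0n.
  rewrite !mxE q0 !mul0r addr0.
  pose z h : 'rV[R]_n := h *: delta_mx 0 j + 0.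
  have L : (fun h : R => h^-1 *: (z h 0 i * A (sqnorm (z h)) -
      (0 : 'rV[R]_n) 0 i * A (sqnorm (0 : 'rV[R]_n)))) @ 0^' --> (i == j)%:R * A 0.
    have c : (i == j)%:R * A (sqnorm (h *: (delta_mx 0 j : 'rV[R]_n)))
        @[h --> (0 : R)] --> (i == j)%:R * A 0.
      apply: cvgM; first exact: cvg_cst.
      have e : sqnorm ((0 : R) *: (delta_mx 0 j : 'rV[R]_n)) = 0.
        by rewrite sqnormZ expr0n mul0r.
      rewrite -[X in A X]e.
      apply: (@continuous_comp _ _ _ (fun h : R => sqnorm (h *: (delta_mx 0 j : 'rV[R]_n))) A).
        apply: (@continuous_comp _ _ _ (fun h : R => h *: (delta_mx 0 j : 'rV[R]_n)) (@sqnorm R n)).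
          exact: scalel_continuous.
        exact: sqnorm_continuous.
      exact: cA.
    have {}c : (i == j)%:R * A (sqnorm (h *: (delta_mx 0 j : 'rV[R]_n)))
        @[h --> (0 : R)^'] --> (i == j)%:R * A 0.
      exact: cvg_within_filter c.
    apply: cvg_trans c; apply: near_eq_cvg; near=> h.
    have h0 : h != 0 by near: h; exact: nbhs_dnbhs_neq.
    rewrite /z !mxE addr0 mul0r subr0 addr0 eqxx /= -mulr_algl scaler1.
    by rewrite -[h * _ * _]mulrA mulKf.
  split; first by apply/cvg_ex; eexists; exact: L.
  exact/cvg_lim.
have sD : 0 < sqnorm x < 1 by rewrite lt_neqAle eq_sym s0 x0.
have := is_deriveM (is_derive_coord x (delta_mx 0 j) i)
  (is_derive_comp1 (dA _ sD) (is_derive_sqnorm x j)).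
congr is_derive; rewrite mxE eqxx /= /GRing.scale /=.
by field.
Unshelve. all: by end_near.
Qed.

Lemma radial_partialE (i : 'I_n) (x : 'rV[R]_n) : unit_ball x ->
  partial i u x = x 0 i * A (sqnorm x).
Proof. by move=> xD; have [_] := radial_partial i xD. Qed.

Lemma radial_is_derive_partial (i j : 'I_n) (x : 'rV[R]_n) : unit_ball x ->
  is_derive x (delta_mx 0 j) (partial i u)
    ((i == j)%:R * A (sqnorm x) + q (sqnorm x) / sqnorm x * (x 0 i * x 0 j)).
Proof.
move=> xD; apply: near_eq_is_derive (radial_partial2 i j xD).
have nD : \forall z \near x, unit_ball z.
  by apply: open_nbhs_nbhs; split => //; exact: open_unit_ball.
by near=> z; rewrite radial_partialE//; near: z.
Unshelve. all: by end_near.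
Qed.

(** Since [|x_i x_j| <= |x|^2], the term is bounded by [|q (|x|^2)|], which tends to [q 0 = 0] at
    the centre. *)
Lemma radial_cross_continuous (i j : 'I_n) :
  continuous (fun x : 'rV[R]_n => q (sqnorm x) / sqnorm x * (x 0 i * x 0 j)).
Proof.
have [_ _ cq q0 _] := prof => x.
have cqs : {for x, continuous (fun x : 'rV[R]_n => q (sqnorm x))}.
  apply: continuous_comp; [exact: sqnorm_continuous|exact: cq].
have [s0|s0] := eqVneq (sqnorm x) 0; last first.
  have c1 : {for x, continuous (fun x : 'rV[R]_n => (sqnorm x)^-1)}.
    by apply: continuousV => //; exact: sqnorm_continuous.
  have c2 : {for x, continuous (fun x : 'rV[R]_n => x 0 i * x 0 j)}.
    by apply: continuousM; exact: coord_continuous.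
  exact: continuousM (continuousM cqs c1) c2.
rewrite /continuous_at s0 invr0 mulr0 mul0r.
apply/(@cvgr0Pnorm_lt _ _ _ (nbhs x) (nbhs_filter x)) => e e0.
have := cqs; rewrite /prop_for /continuous_at s0 q0.
move=> /(@cvgr0Pnorm_lt _ _ _ (nbhs x) (nbhs_filter x)) /(_ e e0).
apply: filterS => z; apply: le_lt_trans.
have [->|z0] := eqVneq (sqnorm z) 0; first by rewrite invr0 mulr0 mul0r normr0.
have zp : 0 < sqnorm z by rewrite lt_neqAle eq_sym z0 sqnorm_ge0.
rewrite normrM normrM normfV (gtr0_norm zp) -mulrA ler_piMr// ler_pdivrMl// mulr1.
rewrite normrM.
have := sqr_coord_le_sqnorm z i; have := sqr_coord_le_sqnorm z j.
rewrite -(real_normK (num_real (z 0 i))) -(real_normK (num_real (z 0 j))) => h1 h2.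
have := sqr_ge0 (`|z 0 i| - `|z 0 j|); lra.
Qed.

Lemma radial_C2_closure : C2_closure (@unit_ball R n) u.
Proof.
have [cPhi cA _ _ _] := prof.
have cAs : continuous (fun x : 'rV[R]_n => A (sqnorm x)).
  by move=> x; apply: continuous_comp; [exact: sqnorm_continuous|exact: cA].
split.
- apply: continuous_subspaceT => x.
  by apply: continuous_comp; [exact: sqnorm_continuous|exact: cPhi].
- by move=> i x xD; have [] := radial_partial i xD.
- by move=> i j x xD; have [] := radial_is_derive_partial i j xD.
- move=> i; exists (fun x : 'rV[R]_n => x 0 i * A (sqnorm x)); split.
    apply: continuous_subspaceT => x.
    by have := continuousM (@coord_continuous R 1 n 0 i x) (cAs x).
  by move=> x xD; rewrite radial_partialE.
- move=> i j; exists (fun x : 'rV[R]_n =>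
    (i == j)%:R * A (sqnorm x) + q (sqnorm x) / sqnorm x * (x 0 i * x 0 j)).
  split; last by move=> x xD; have [_ h] := radial_is_derive_partial i j xD; exact: esym h.
  apply: continuous_subspaceT => x.
  have c1 : {for x, continuous (fun x : 'rV[R]_n => (i == j)%:R * A (sqnorm x))}.
    have c0 : {for x, continuous (fun _ : 'rV[R]_n => (i == j)%:R : R)} by exact: cst_continuous.
    exact: continuousM c0 (cAs x).
  exact: continuousD c1 (@radial_cross_continuous i j x).
Qed.

Lemma radial_hessian (x : 'rV[R]_n) : unit_ball x ->
  hessian u x = (A (sqnorm x))%:M + (q (sqnorm x) / sqnorm x) *: (x^T *m x).
Proof.
move=> xD; apply/matrixP => i j; rewrite !mxE big_ord1 !mxE.
by have [_ h] := radial_is_derive_partial i j xD; rewrite -mulr_natl; exact: h.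
Qed.

End Radial.

(** * Rank one perturbations of scalar matrices and strict convexity *)

Lemma det_scalar_rank1 (R : realType) (n : nat) (a c : R) (x : 'rV[R]_n) :
  (0 < n)%N -> a != 0 ->
  \det (a%:M + c *: (x^T *m x)) = a ^+ n.-1 * (a + c * sqnorm x).
Proof.
move=> n0 a0.
(* The lower left block of this bordered matrix is cleared once by row operations, giving the wanted
   determinant, and once by column operations, giving the scalar formula. *)
pose M : 'M[R]_(1 + n) := block_mx 1%:M (- c *: x) x^T a%:M.
have E1 : \det M = \det (a%:M + c *: (x^T *m x)).
  have -> : M = block_mx 1%:M 0 x^T 1%:M *m block_mx 1%:M (- c *: x) 0 (a%:M + c *: (x^T *m x)).
    rewrite mulmx_block !mul1mx !mul0mx !mulmx1 !addr0 -scalemxAr !scaleNr.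
    by rewrite addrCA addNr addr0 /M scaleNr.
  by rewrite det_mulmx det_lblock det_ublock !det1 !mul1r.
have E2 : \det M = (1 + a^-1 * c * sqnorm x) * a ^+ n.
  have /(congr1 determinant) : M *m block_mx 1%:M 0 (- a^-1 *: x^T) 1%:M =
      block_mx (1 + a^-1 * c * sqnorm x)%:M (- c *: x) 0 a%:M.
    rewrite mulmx_block !mulmx1 !mulmx0 !add0r mul_scalar_mx scalerA mulrN mulfV//.
    rewrite scaleN1r addrN -scalemxAl -scalemxAr scalerA mulrNN.
    congr (block_mx _ _ _ _); apply/matrixP => i j; rewrite !ord1 !mxE !mulr1n.
    congr (1 + _); rewrite [a^-1 * c]mulrC; congr (_ * _).
    by apply: eq_bigr => k _; rewrite mxE expr2.
  rewrite det_mulmx det_lblock !det1 !mulr1 => ->.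
  by rewrite det_ublock det_scalar1 det_scalar.
rewrite -E1 E2; case: n n0 x {M E1 E2} => // m _ x.
by rewrite exprS /=; field.
Qed.

Definition dot (R : realType) (n : nat) (x y : 'rV[R]_n) : R := \sum_(i < n) x 0 i * y 0 i.

Lemma sqnormB (R : realType) (n : nat) (a b : R) (x y : 'rV[R]_n) :
  sqnorm (a *: x - b *: y) = a ^+ 2 * sqnorm x - 2 * a * b * dot x y + b ^+ 2 * sqnorm y.
Proof.
rewrite /sqnorm /dot !mulr_sumr -sumrB -big_split; apply: eq_bigr => i _ /=.
by rewrite !mxE; ring.
Qed.

(** Cauchy-Schwarz, by expanding the squared norm of [dot x y *: x - sqnorm x *: y]. *)
Lemma dot_sqr_le (R : realType) (n : nat) (x y : 'rV[R]_n) :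
  dot x y ^+ 2 <= sqnorm x * sqnorm y.
Proof.
have [s0|s0] := eqVneq (sqnorm x) 0.
  by rewrite (sqnorm_eq0 s0) /dot big1 ?expr0n ?mulr_ge0 ?sqnorm_ge0// => i _; rewrite mxE mul0r.
have xp : 0 < sqnorm x by rewrite lt_neqAle eq_sym s0 sqnorm_ge0.
have := sqnorm_ge0 (dot x y *: x - sqnorm x *: y); rewrite sqnormB.
have -> : dot x y ^+ 2 * sqnorm x - 2 * dot x y * sqnorm x * dot x y + sqnorm x ^+ 2 * sqnorm y
  = sqnorm x * (sqnorm x * sqnorm y - dot x y ^+ 2) by ring.
by rewrite pmulr_rge0// subr_ge0.
Qed.

Lemma quad_scalar_rank1 (R : realType) (n : nat) (a c : R) (x y : 'rV[R]_n) :
  quad (a%:M + c *: (x^T *m x)) y = a * sqnorm y + c * dot x y ^+ 2.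
Proof.
have E : y *m y^T = (sqnorm y)%:M.
  by apply/matrixP => i j; rewrite !ord1 !mxE mulr1n; apply: eq_bigr => k _; rewrite mxE expr2.
have E2 : x *m y^T = (dot x y)%:M.
  by apply/matrixP => i j; rewrite !ord1 !mxE mulr1n; apply: eq_bigr => k _; rewrite mxE.
have E3 : y *m x^T = (dot x y)%:M by rewrite -[LHS]trmxK trmx_mul trmxK E2 tr_scalar_mx.
rewrite /quad mulmxDr mulmxDl mul_mx_scalar -scalemxAl E -scalemxAr -scalemxAl mulmxA E3.
by rewrite mul_scalar_mx -scalemxAl E2 !mxE !mulr1n expr2.
Qed.

Lemma unit_ball_convex (R : realType) (n : nat) (x y : 'rV[R]_n) (t : R) :
  unit_ball x -> unit_ball y -> 0 <= t <= 1 -> unit_ball (y + t *: (x - y)).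
Proof.
rewrite unit_ballE /= => xD yD /andP[t0 t1].
have -> : y + t *: (x - y) = (1 - t) *: y - (- t) *: x.
  by apply/rowP => i; rewrite !mxE; ring.
rewrite sqnormB.
have := sqnorm_ge0 (1 *: x - 1 *: y); rewrite sqnormB.
have -> : dot y x = dot x y by apply: eq_bigr => i _; rewrite mulrC.
move=> h.
have [->|tn0] := eqVneq t 0.
  by rewrite !(subr0, oppr0, expr0n, expr1n, mulr0, mul0r, addr0, mul1r)/=; lra.
have tp : 0 < t by rewrite lt_neqAle eq_sym tn0.
have h1 : t * sqnorm x < t by rewrite gtr_pMr.
have h2 : (1 - t) * sqnorm y <= 1 - t by rewrite ler_piMr ?subr_ge0// ltW.
(* The squared norm of the combination is [t |x|^2 + (1 - t) |y|^2 - t (1 - t) |x - y|^2]. *)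
have : 0 <= t * (1 - t) * (1 ^+ 2 * sqnorm x - 2 * 1 * 1 * dot x y + 1 ^+ 2 * sqnorm y).
  by rewrite mulr_ge0// mulr_ge0// subr_ge0.
by rewrite expr1n !mul1r; nra.
Qed.

(** On the segment from [y] to [x] the mean slopes before and after the parameter [t] are
    derivatives at points [c1 < c2], and the positive second derivative orders them strictly. *)
Lemma strictly_convex_pos_def (R : realType) (n : nat) (u : 'rV[R]_n -> R) :
  C2_on (@unit_ball R n) u ->
  (forall x y, unit_ball x -> y != 0 -> 0 < quad (hessian u x) y) ->
  strictly_convex_on (@unit_ball R n) u.
Proof.
move=> u2 upos x y t xD yD xy t0 t1.
set v := x - y; have v0 : v != 0 by rewrite subr_eq0.
have L s (s01 : 0 <= s <= 1) :=
  is_derive_line2 (@open_unit_ball R n) u2 (unit_ball_convex xD yD s01).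
pose g s := u (y + s *: v); pose g' s := 'D_v u (y + s *: v).
have MV (f f' : R -> R) a b : 0 <= a -> a < b -> b <= 1 ->
    (forall s : R, 0 <= s <= 1 -> is_derive s 1 f (f' s)) ->
    exists2 c, a < c < b & f b - f a = f' c * (b - a).
  move=> a0 ab b1 ff'; have [||c cI E] := @MVT R f f' a b ab.
  - move=> s; rewrite in_itv/= => /andP[s0 s1]; apply: ff'.
    by rewrite (le_trans a0 (ltW s0)) (le_trans (ltW s1) b1).
  - apply: derivable_within_continuous => s; rewrite in_itv/= => /andP[s0 s1].
    have [|//] := ff' s.
    by rewrite (le_trans a0 s0) (le_trans s1 b1).
  - by exists c => //; move: cI; rewrite in_itv.
have [c1 /andP[c10 c1t] E1] := MV g g' 0 t (lexx 0) t0 (ltW t1) (fun s h => (L s h).1).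
have [c2 /andP[tc2 c21] E2] := MV g g' t 1 (ltW t0) t1 (lexx 1) (fun s h => (L s h).1).
have c12 : c1 < c2 by exact: lt_trans tc2.
have [c3 /andP[c31 c32] E3] := MV g' _ c1 c2 (ltW c10) c12 (ltW c21) (fun s h => (L s h).2).
have g'12 : g' c1 < g' c2.
  rewrite -subr_gt0 E3 mulr_gt0 ?subr_gt0//; apply: upos => //.
  apply: unit_ball_convex => //.
  by rewrite (ltW (lt_trans c10 c31)) (ltW (lt_trans c32 c21)).
have g1 : g 1 = u x by rewrite /g scale1r addrC subrK.
have g0 : g 0 = u y by rewrite /g scale0r addr0.
have gt : g t = u (t *: x + (1 - t) *: y).
  by congr u; apply/rowP => i; rewrite !mxE; ring.
rewrite -gt -g1 -g0.
have h := ltr_pM2l (mulr_gt0 t0 (_ : 0 < 1 - t)) (g' c1) (g' c2).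
have := h; rewrite subr_gt0 => /(_ t1); rewrite g'12 => {}h.
have e1 : g t = g 0 + g' c1 * t by move: E1; rewrite subr0 => <-; ring.
have e2 : g 1 = g t + g' c2 * (1 - t) by move: E2 => <-; ring.
by move: h; rewrite e2 e1; lra.
Qed.

(** [A s] and [A s + q s] are the tangential and radial eigenvalues of the Hessian. When [q s] is
    negative, Cauchy-Schwarz bounds the rank one term below by [q s * |y|^2]. *)
Lemma radial_strictly_convex (R : realType) (n : nat) (Phi A q : R -> R) :
  radial_profile Phi A q ->
  (forall s, 0 <= s < 1 -> 0 < A s /\ 0 < A s + q s) ->
  strictly_convex_on (@unit_ball R n) (fun x => Phi (sqnorm x)).
Proof.
move=> prof pos; apply: strictly_convex_pos_def.
  exact: C2_on_C2_closure (@open_unit_ball R n) (radial_C2_closure n prof).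
move=> x y xD y0; rewrite (radial_hessian prof xD) quad_scalar_rank1.
have [Ap Aqp] := pos _ (unit_ball_sqnorm xD).
have yp : 0 < sqnorm y.
  by rewrite lt_neqAle sqnorm_ge0 andbT eq_sym; apply: contra_neq y0; exact: sqnorm_eq0.
have [q0|q0] := leP 0 (q (sqnorm x)).
  by rewrite ltr_pwDl ?mulr_gt0// mulr_ge0 ?sqr_ge0// divr_ge0// sqnorm_ge0.
have [s0|s0] := eqVneq (sqnorm x) 0.
  have -> : q (sqnorm x) / sqnorm x = 0 by rewrite s0 invr0 mulr0.
  by rewrite mul0r addr0 mulr_gt0.
have xp : 0 < sqnorm x by rewrite lt_neqAle eq_sym s0 sqnorm_ge0.
have : q (sqnorm x) * sqnorm y <= q (sqnorm x) / sqnorm x * dot x y ^+ 2.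
  rewrite -mulrA ler_wnM2l ?(ltW q0)// ler_pdivrMl//; exact: dot_sqr_le.
have : 0 < (A (sqnorm x) + q (sqnorm x)) * sqnorm y by rewrite mulr_gt0.
by lra.
Qed.

(** * Uniqueness *)

Lemma partial_scale (R : realType) (n : nat) (D : set 'rV[R]_n)
    (u : 'rV[R]_n -> R) (c : R) (i j : 'I_n) (x : 'rV[R]_n) : open D ->
  C2_on D u -> D x ->
  is_derive x (delta_mx 0 i) (fun x => c * u x) (c * partial i u x) /\
  is_derive x (delta_mx 0 j) (partial i (fun x => c * u x))
    (c * partial j (partial i u) x).
Proof.
move=> oD [u1 u2] Dx.
have H z : D z -> is_derive z (delta_mx 0 i) (fun x => c * u x) (c * partial i u z).
  move=> Dz; have du : is_derive z (delta_mx 0 i) u (partial i u z).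
    by split => //; apply: (u1 i z Dz).1.
  by have := @is_deriveZ _ _ _ _ c _ _ _ du.
split; first exact: H.
have nD : \forall z \near x, D z by exact: open_nbhs_nbhs.
apply: (@near_eq_is_derive _ _ _ (fun x => c * partial i u x)).
  near=> z; have Dz : D z by near: z.
  by have [_ h] := H z Dz; exact: esym h.
have du : is_derive x (delta_mx 0 j) (partial i u) (partial j (partial i u) x).
  by split => //; apply: (u2 i j x Dx).1.
by have := @is_deriveZ _ _ _ _ c _ _ _ du.
Unshelve. all: by end_near.
Qed.

Lemma within_continuousZ (R : realType) (n : nat) (A : set 'rV[R]_n)
    (f : 'rV[R]_n -> R) (c : R) : {within A, continuous f} ->
  {within A, continuous (fun x => c * f x)}.
Proof.
move=> /subspace_continuousP fc; apply/subspace_continuousP => x Ax.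
by apply: cvgM (fc x Ax); exact: cvg_cst.
Qed.

Lemma C2_closure_scale (R : realType) (n : nat) (D : set 'rV[R]_n)
    (u : 'rV[R]_n -> R) (c : R) : open D ->
  C2_closure D u -> C2_closure D (fun x => c * u x).
Proof.
move=> oD uC; have u2 := C2_on_C2_closure oD uC.
have [uc _ _ e1 e2] := uC.
have P i j x Dx := @partial_scale _ _ _ u c i j x oD u2 Dx.
split.
- exact: within_continuousZ.
- by move=> i x Dx; have [[]] := P i i x Dx.
- by move=> i j x Dx; have [_ []] := P i j x Dx.
- move=> i; have [g [gc gE]] := e1 i; exists (fun x => c * g x).
  split; first exact: within_continuousZ.
  by move=> x Dx; rewrite gE//; have [[_ h] _] := P i i x Dx; exact: esym h.
- move=> i j; have [g [gc gE]] := e2 i j; exists (fun x => c * g x).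
  split; first exact: within_continuousZ.
  by move=> x Dx; rewrite gE//; have [_ [_ h]] := P i j x Dx; exact: esym h.
Qed.

Lemma hessian_scale (R : realType) (n : nat) (D : set 'rV[R]_n)
    (u : 'rV[R]_n -> R) (c : R) (x : 'rV[R]_n) : open D ->
  C2_closure D u -> D x -> hessian (fun x => c * u x) x = c *: hessian u x.
Proof.
move=> oD uC Dx; have u2 := C2_on_C2_closure oD uC.
apply/matrixP => i j; rewrite !mxE.
by have [_ [_ h]] := @partial_scale _ _ _ u c i j x oD u2 Dx; exact: h.
Qed.

(** The determinant is homogeneous of degree n, so scaling [u] by [l^(gamma / n)] scales its
    determinant by [l^gamma], exactly what [g <= l f] allows. *)
Lemma scaled_comparison (R : realType) (n : nat) (u v f g : 'rV[R]_n -> R)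
    (gamma l : R) : (0 < n)%N -> 0 < gamma -> 0 < l ->
  C2_closure (@unit_ball R n) u -> C2_closure (@unit_ball R n) v ->
  strictly_convex_on (@unit_ball R n) v ->
  (forall x, unit_ball x -> [/\ v x < 0, f x < 0 & g x < 0]) ->
  (forall x, frontier (@unit_ball R n) x -> u x = 0 /\ v x = 0) ->
  (forall x, unit_ball x -> \det (hessian u x) = (- f x) `^ gamma) ->
  (forall x, unit_ball x -> \det (hessian v x) = (- g x) `^ gamma) ->
  (forall x, unit_ball x -> g x <= l * f x) ->
  forall x, unit_ball x -> v x <= l `^ (gamma / n%:R) * u x.
Proof.
move=> n0 gamma0 l0 uC vC vc neg bd Hu Hv gf.
have oD := @open_unit_ball R n.
apply: (comparison n0 _ vC vc).
- exact: C2_closure_scale.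
- by move=> x /neg[].
- by move=> x /bd[-> ->]; rewrite mulr0.
- by move=> x Dx; rewrite Hv// powR_gt0// oppr_gt0; have [] := neg x Dx.
- move=> x Dx; rewrite (hessian_scale (l `^ (gamma / n%:R)) oD uC Dx).
  rewrite detZ (Hv x Dx) (Hu x Dx).
  have [_ fx gx] := neg x Dx.
  rewrite -powR_mulrn ?powR_ge0// -powRrM divfK ?pnatr_eq0 -?lt0n//.
  rewrite -powRM ?oppr_ge0 ?(ltW l0) ?(ltW fx)//.
  apply: ge0_ler_powR; rewrite ?nnegrE ?(ltW gamma0)//.
  + by rewrite mulr_ge0 ?oppr_ge0 ?(ltW l0) ?(ltW fx).
  + by rewrite oppr_ge0 ltW.
  + by rewrite mulrN lerN2 gf.
Qed.

(** * Bounds by multiples of 1 - |x|^2 *)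

Lemma convex_le_cone (R : realType) (n : nat) (v : 'rV[R]_n -> R) (x : 'rV[R]_n) :
  strictly_convex_on (@unit_ball R n) v ->
  (forall x, unit_ball x -> v x < 0) -> unit_ball x ->
  v x <= v 0 / 2 * (1 - sqnorm x).
Proof.
move=> vc v0 Dx.
have D0 : unit_ball (0 : 'rV[R]_n).
  by rewrite unit_ballE /sqnorm /= big1// => i _; rewrite mxE expr0n.
have := unit_ball_sqnorm Dx; set s := sqnorm x => /andP[s0 s1].
have [x0|x0] := eqVneq x 0.
  by rewrite /s x0 /sqnorm big1 => [|i _]; [have := v0 _ D0; lra|rewrite mxE expr0n].
(* Convexity is known only in the open ball, so [x / |x|] cannot be used. Here
   [t^2 - s = ((1 - s) / 2)^2 > 0] keeps [x / t] inside, and [1 - t] is the wanted factor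
   [(1 - s) / 2]. *)
pose t := (1 + s) / 2.
have t0 : 0 < t by rewrite /t; lra.
have t1 : t < 1 by rewrite /t; lra.
have Dz : unit_ball (t^-1 *: x).
  rewrite unit_ballE /= sqnormZ -/s exprVn ltr_pdivrMl ?exprn_gt0// mulr1.
  by rewrite /t; nra.
have := vc _ _ t Dz D0 _ t0 t1.
rewrite scaler0 addr0 scalerA mulfV ?lt0r_neq0// scale1r.
rewrite scaler_eq0 invr_eq0 negb_or x0 lt0r_neq0// => /(_ isT) h.
apply: le_trans (ltW h) _.
have : t * v (t^-1 *: x) <= 0 by rewrite pmulr_rle0// ltW// v0.
by rewrite /t; lra.
Qed.

(** The paraboloid has Hessian [C] times the identity and determinant [C ^+ n]; in radial form its
    profile is [A = C], [q = 0]. *)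
Lemma barrier_le (R : realType) (n : nat) (u : 'rV[R]_n -> R) (C : R) : (0 < n)%N ->
  0 < C -> C2_closure (@unit_ball R n) u ->
  (forall x, frontier (@unit_ball R n) x -> u x = 0) ->
  (forall x, unit_ball x -> \det (hessian u x) <= C ^+ n) ->
  forall x, unit_ball x -> C / 2 * (sqnorm x - 1) <= u x.
Proof.
move=> n0 C0 uC bd Hu.
have prof : radial_profile (fun s => C / 2 * (s - 1)) (cst C) (cst (0 : R)).
  split; [|exact: cst_continuous|exact: cst_continuous|by []|split].
  - move=> s; have c1 : {for s, continuous (fun _ : R => C / 2)} by exact: cst_continuous.
    have c2 : {for s, continuous (fun _ : R => 1 : R)} by exact: cst_continuous.
    have c3 : {for s, continuous (fun t : R => t)} by exact: cvg_id.
    exact: continuousM c1 (continuousB c3 c2).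
  - exists (C / 2) => s /andP[s0 _].
    by rewrite -mulrBr opprB addrA subrK subr0 normrM !ger0_norm ?divr_ge0 ?(ltW C0).
  - move=> s _; have h : is_derive s 1 (fun s : R => s - 1) (1 - 0 : R).
      by have := @is_deriveB R R R id (cst 1) s 1 1 0 (is_derive_id s 1) (is_derive_cst _ _ _).
    by have := @is_deriveZ _ _ _ _ (C / 2) _ _ _ h; rewrite subr0 scaler1.
  - by move=> s _; rewrite !mul0r; exact: is_derive_cst.
apply: (comparison n0 uC (radial_C2_closure n prof)).
- by apply: radial_strictly_convex prof _ => s _; rewrite /cst addr0.
- move=> x /unit_ball_sqnorm/andP[_ s1].
  by rewrite pmulr_rlt0 ?divr_gt0// subr_lt0.
- by move=> x fx; rewrite bd// frontier_unit_ball// subrr mulr0.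
- move=> x Dx; rewrite (radial_hessian prof Dx) det_scalar_rank1 ?lt0r_neq0//=.
  by rewrite mul0r mul0r addr0 mulr_gt0 ?exprn_gt0.
- move=> x Dx; rewrite (radial_hessian prof Dx) det_scalar_rank1 ?lt0r_neq0//=.
  by rewrite mul0r mul0r addr0 -exprSr prednK// Hu.
Qed.

Lemma comparable_lower (R : realType) (n : nat) (u v f : 'rV[R]_n -> R) (gamma : R) :
  (0 < n)%N -> 0 < gamma ->
  C2_closure (@unit_ball R n) u -> strictly_convex_on (@unit_ball R n) v ->
  {within closure (@unit_ball R n), continuous f} ->
  (forall x, unit_ball x -> [/\ u x < 0, v x < 0 & f x < 0]) ->
  (forall x, frontier (@unit_ball R n) x -> u x = 0) ->
  (forall x, unit_ball x -> \det (hessian u x) = (- f x) `^ gamma) ->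
  exists2 l, 0 < l <= 1 & forall x, unit_ball x -> v x <= l * u x.
Proof.
move=> n0 gamma0 uC vc fc neg bd Hu.
have D0 : unit_ball (0 : 'rV[R]_n).
  by rewrite unit_ballE /sqnorm /= big1// => i _; rewrite mxE expr0n.
have [c _ cmin] := EVT_min_rV (ex_intro _ 0 (@subset_closure _ _ _ D0))
  (@compact_closure_unit_ball R n) fc.
pose C := (- f c) `^ gamma + 1.
have C1 : 1 <= C by rewrite lerDr powR_ge0.
have C0 : 0 < C by exact: lt_le_trans C1.
have uC' x : unit_ball x -> C / 2 * (sqnorm x - 1) <= u x.
  apply: barrier_le => // {}x Dx; rewrite Hu//.
  apply: (@le_trans _ _ C); last by rewrite -[leLHS]expr1 ler_weXn2l.
  rewrite /C ler_wpDr//; have fx : 0 <= - f x by have [_ _ ?] := neg x Dx; rewrite oppr_ge0 ltW.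
  have fcx : - f x <= - f c.
    by rewrite lerN2; apply: cmin; rewrite inE; exact: subset_closure.
  by apply: ge0_ler_powR; rewrite ?nnegrE ?(ltW gamma0)// (le_trans fx).
have v0 : v 0 < 0 by have [] := neg 0 D0.
(* [l * C <= - v 0] matches the two bounds; the 1 keeps [l] in the range over which the supremum is
   later taken. *)
pose l := Num.min 1 (- v 0 / C).
have l0 : 0 < l by rewrite lt_min ltr01 divr_gt0// oppr_gt0.
exists l; first by rewrite l0 ge_min lexx.
move=> x Dx; have vx : v x <= v 0 / 2 * (1 - sqnorm x).
  by apply: convex_le_cone => // z /neg[].
apply: (le_trans vx).
have := ler_wpM2l (ltW l0) (uC' _ Dx); apply: le_trans.
have lC : l * C <= - v 0 by rewrite -ler_pdivlMr// ge_min lexx orbT.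
have /andP[_ s1] := unit_ball_sqnorm Dx.
have : l * C * (1 - sqnorm x) <= - v 0 * (1 - sqnorm x).
  by rewrite ler_wpM2r// subr_ge0 ltW.
by lra.
Qed.

Lemma lt_powR_lt1 (R : realType) (l p : R) : 0 < l < 1 -> p < 1 -> l < l `^ p.
Proof.
move=> /andP[l0 l1] p1; rewrite -ltr_ln ?posrE ?powR_gt0// ln_powR.
by rewrite ltr_nMl// ln_lt0// l0.
Qed.

(* If v1 <= l u1, two comparisons give v1 <= l^p u1 with p = alpha beta / n^2 < 1,
   so the largest admissible l <= 1 is 1. *)
Lemma convex_solution_le (R : realType) (n : nat) (alpha beta : R)
    (u1 u2 v1 v2 : 'rV[R]_n -> R) : (0 < n)%N -> 0 < alpha -> 0 < beta ->
  alpha * beta < n%:R ^+ 2 ->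
  convex_solution alpha beta u1 u2 -> convex_solution alpha beta v1 v2 ->
  forall x, unit_ball x -> v1 x <= u1 x.
Proof.
move=> n0 a0 b0 ab [[u1C u2C] [u1c u2c] Hu uneg ubd] [[v1C v2C] [v1c v2c] Hv vneg vbd].
have nR : 0 < n%:R :> R by rewrite ltr0n.
pose p := beta / n%:R * (alpha / n%:R).
have p1 : p < 1.
  have -> : p = alpha * beta / n%:R ^+ 2 by rewrite /p; field; rewrite lt0r_neq0.
  by rewrite ltr_pdivrMr ?exprn_gt0// mul1r.
have step l : 0 < l -> (forall x, unit_ball x -> v1 x <= l * u1 x) ->
    forall x, unit_ball x -> v1 x <= l `^ p * u1 x.
  move=> l0 Hl; rewrite /p powRrM.
  have H2 x : unit_ball x -> v2 x <= l `^ (beta / n%:R) * u2 x.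
    apply: (scaled_comparison n0 b0 l0 u2C v2C v2c _ _ _ _ Hl).
    - by move=> z Dz; split; [exact: (vneg z Dz).2|exact: (uneg z Dz).1|exact: (vneg z Dz).1].
    - by move=> z fz; split; [exact: (ubd z fz).2|exact: (vbd z fz).2].
    - by move=> z Dz; exact: (Hu z Dz).2.
    - by move=> z Dz; exact: (Hv z Dz).2.
  have k0 : 0 < l `^ (beta / n%:R) by rewrite powR_gt0.
  apply: (scaled_comparison n0 a0 k0 u1C v1C v1c _ _ _ _ H2).
  - by move=> z Dz; split; [exact: (vneg z Dz).1|exact: (uneg z Dz).2|exact: (vneg z Dz).2].
  - by move=> z fz; split; [exact: (ubd z fz).1|exact: (vbd z fz).1].
  - by move=> z Dz; exact: (Hu z Dz).1.
  - by move=> z Dz; exact: (Hv z Dz).1.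
pose S := [set l : R | 0 < l <= 1 /\ forall x, unit_ball x -> v1 x <= l * u1 x].
have [l0 l01 Hl0] : exists2 l, 0 < l <= 1 & forall x, unit_ball x -> v1 x <= l * u1 x.
  have u2cont : {within closure (@unit_ball R n), continuous u2} by have [] := u2C.
  apply: (comparable_lower n0 a0 u1C v1c u2cont).
  - by move=> z Dz; split; [exact: (uneg z Dz).1|exact: (vneg z Dz).1|exact: (uneg z Dz).2].
  - by move=> z fz; exact: (ubd z fz).1.
  - by move=> z Dz; exact: (Hu z Dz).1.
have Sl0 : S l0 by split.
have Sub : ubound S 1 by move=> l [/andP[]].
have hS : has_sup S by split; [exists l0|exists 1].
set m := sup S.
have ml0 : l0 <= m by apply: ub_le_sup => //; exists 1.
have m0 : 0 < m by move: l01 => /andP[l00 _]; exact: lt_le_trans ml0.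
have m1 : m <= 1 by apply: ge_sup => //; exists l0.
(* The supremum is attained: at fixed [x], since [u1 x < 0], the condition reads
   [l <= v1 x / u1 x]. *)
have Hm x : unit_ball x -> v1 x <= m * u1 x.
  move=> Dx; have ux := (uneg x Dx).1.
  rewrite -ler_ndivlMr//; apply: ge_sup; first by exists l0.
  by move=> l [_ /(_ x Dx)]; rewrite ler_ndivlMr.
have [m1'|m1'] := ltP m 1; last first.
  have mE : m = 1 by apply/eqP; rewrite eq_le m1.
  by move=> x Dx; rewrite -[u1 x]mul1r -mE Hm.
have mp : m < m `^ p by apply: lt_powR_lt1 => //; rewrite m0.
have : m `^ p <= m.
  apply: ub_le_sup; first by exists 1.
  split; last exact: step.
  have e : (1 : R) `^ p = 1 by rewrite powR1.
  rewrite powR_gt0//= -[leRHS]e; apply: ge0_ler_powR; rewrite ?nnegrE ?ler01 ?(ltW m0)//.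
  by rewrite mulr_ge0// divr_ge0// ltW.
by rewrite leNgt mp.
Qed.

Lemma convex_solution_sym (R : realType) (n : nat) (alpha beta : R)
    (u1 u2 : 'rV[R]_n -> R) :
  convex_solution alpha beta u1 u2 -> convex_solution beta alpha u2 u1.
Proof.
move=> [[c1 c2] [d1 d2] H neg bd]; split => //.
- by move=> x /H[].
- by move=> x /neg[].
- by move=> x /bd[].
Qed.

Lemma convex_solution_unique (R : realType) (n : nat) (alpha beta : R)
    (u1 u2 v1 v2 : 'rV[R]_n -> R) : (0 < n)%N -> 0 < alpha -> 0 < beta ->
  alpha * beta < n%:R ^+ 2 ->
  convex_solution alpha beta u1 u2 -> convex_solution alpha beta v1 v2 ->
  forall x, closure (@unit_ball R n) x -> v1 x = u1 x /\ v2 x = u2 x.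
Proof.
move=> n0 a0 b0 ab U V x cx.
have [Dx|fx] := closure_unit_ballP cx; last first.
  have [_ _ _ _ /(_ x fx)[-> ->]] := U.
  by have [_ _ _ _ /(_ x fx)[-> ->]] := V.
have ba : beta * alpha < n%:R ^+ 2 by rewrite mulrC.
have U' := convex_solution_sym U; have V' := convex_solution_sym V.
split; apply/eqP; rewrite eq_le; apply/andP; split.
- exact: (convex_solution_le n0 a0 b0 ab U V Dx).
- exact: (convex_solution_le n0 a0 b0 ab V U Dx).
- exact: (convex_solution_le n0 b0 a0 ba U' V' Dx).
- exact: (convex_solution_le n0 b0 a0 ba V' U' Dx).
Qed.

(** * The radial system *)

(** Truncating the upper limit makes primitives total functions, constant outside [0, 1], so
    monotonicity and continuity hold on the whole line without endpoint cases. *)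
Definition clamp (R : realType) (r : R) : R := Num.min 1 (Num.max 0 r).

Lemma clamp01 (R : realType) (r : R) : 0 <= clamp r <= 1.
Proof. by rewrite /clamp le_min ler01 le_max lexx ge_min lexx. Qed.

Lemma clamp_id (R : realType) (r : R) : 0 <= r <= 1 -> clamp r = r.
Proof. by move=> /andP[r0 r1]; rewrite /clamp max_r// min_r. Qed.

Lemma clamp_le (R : realType) (a b : R) : a <= b -> clamp a <= clamp b.
Proof.
move=> ab; rewrite /clamp le_min ge_min lexx /= ge_min; apply/orP; right.
by rewrite ge_max !le_max lexx ab orbT.
Qed.

Lemma clamp_lip (R : realType) (a b : R) : a <= b -> clamp b - clamp a <= b - a.
Proof.
by rewrite /clamp /Num.min /Num.max; do ![case: ifP]; lra.
Qed.

(** * Primitives on the unit interval *)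

Definition primitive (R : realType) (f : R -> R) (r : R) : R :=
  \int[@lebesgue_measure R]_(t in `[0, clamp r]) f t.

Section Primitive.
Context (R : realType).
Notation mu := (@lebesgue_measure R).
Definition integrable01 (f : R -> R) := mu.-integrable `[0, 1] (EFin \o f).
Implicit Types (f g : R -> R).

Lemma integrable01_sub f (a b : itv_bound R) : (BLeft 0 <= a)%O ->
  (b <= BRight 1)%O -> integrable01 f ->
  mu.-integrable [set` Interval a b] (EFin \o f).
Proof. by move=> a0 b1; apply: integrableS => //; exact: subset_itv. Qed.

Lemma primitiveB f (a b : R) : integrable01 f -> a <= b ->
  primitive f b - primitive f a = \int[mu]_(t in `]clamp a, clamp b]) f t.
Proof.
move=> fi ab; have /andP[a0 a1] := clamp01 a; have /andP[b0 b1] := clamp01 b.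
rewrite /primitive Rintegral_itvB ?bnd_simp//; last exact: clamp_le.
by apply: integrable01_sub fi; rewrite ?bnd_simp.
Qed.

Lemma primitive0 f : primitive f 0 = 0.
Proof. by rewrite /primitive clamp_id ?lexx ?ler01// set_itv1 Rintegral_set1. Qed.

Lemma primitive_npos f (r : R) : r <= 0 -> primitive f r = 0.
Proof.
move=> r0; rewrite /primitive /clamp max_l// min_r ?ler01//.
by rewrite set_itv1 Rintegral_set1.
Qed.

(** Stated for increments because one integration starts at 0 ([mass]) and the other ends at 1
    ([solve]). *)
Lemma primitive_le f g (a b : R) : integrable01 f -> integrable01 g -> a <= b ->
  (forall t, 0 <= t <= 1 -> clamp a < t <= clamp b -> f t <= g t) ->
  primitive f b - primitive f a <= primitive g b - primitive g a.
Proof.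
move=> fi gi ab fg; rewrite !primitiveB//.
have /andP[a0 a1] := clamp01 a; have /andP[b0 b1] := clamp01 b.
apply: le_Rintegral => //.
- by apply: integrable01_sub fi; rewrite ?bnd_simp.
- by apply: integrable01_sub gi; rewrite ?bnd_simp.
- move=> t /=; rewrite in_itv/= => /andP[at1 tb]; apply: fg; last by rewrite at1 tb.
  by rewrite (le_trans a0 (ltW at1)) (le_trans tb b1).
Qed.

Lemma is_derive_primitive f (r : R) : integrable01 f -> 0 < r < 1 ->
  {for r, continuous f} -> is_derive r 1 (primitive f) (f r).
Proof.
move=> fi /andP[r0 r1] fc.
have [d1 d2] := continuous_FTC1_closed r1 fi r0 fc.
have h : is_derive r 1 (fun x => \int[mu]_(t in `[0, x]) f t) (f r).
  by split; [exact: d1|rewrite -derive1E; exact: d2].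
apply: near_eq_is_derive h; near=> x.
rewrite /primitive clamp_id//; apply/andP; split; apply: ltW; near: x.
  exact: lt_nbhsr.
exact: lt_nbhsl.
Unshelve. all: by end_near.
Qed.

Lemma continuous_integrable01 f : continuous f -> integrable01 f.
Proof.
move=> fc; apply: continuous_compact_integrable; first exact: segment_compact.
exact: continuous_subspaceT.
Qed.

Lemma primitive_cst (C r : R) : primitive (cst C) r = C * clamp r.
Proof.
have /andP[r0 r1] := clamp01 r.
rewrite /primitive Rintegral_cst//= lebesgue_measure_itv/= lte_fin.
move: r0; rewrite le_eqVlt => /predU1P[<-|r0]; first by rewrite ltxx.
by rewrite r0 -EFinD subr0.
Qed.

(** In the fixed point argument integrands are known only to be monotone or to have a monotone
    factor, so integrability rests on measurability and a bound, not on continuity. *)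
Lemma measurable_integrable01 f (C : R) : measurable_fun [set: R] f ->
  (forall t, 0 <= t <= 1 -> 0 <= f t <= C) -> integrable01 f.
Proof.
move=> mf f01; apply: measurable_bounded_integrable => //.
- by rewrite /= lebesgue_measure_itv/= lte_fin ltr01 -EFinD ltry.
- exact: measurable_funTS.
- exists C; split; first exact: num_real.
  move=> x x1 t /=; rewrite in_itv/= => /f01/andP[f0 f1].
  by rewrite ger0_norm// (le_trans f1)// ltW.
Qed.

Lemma primitive_clamp f (r : R) : primitive f (clamp r) = primitive f r.
Proof. by rewrite /primitive clamp_id// clamp01. Qed.

Lemma primitive_ge0 f (r : R) : (forall t, 0 <= t <= 1 -> 0 <= f t) ->
  0 <= primitive f r.
Proof.
move=> f0; apply: Rintegral_ge0 => t; rewrite /= in_itv/= => /andP[t0 t1].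
by apply: f0; rewrite t0 (le_trans t1)//; have /andP[] := clamp01 r.
Qed.

Lemma primitiveZ f (c r : R) : integrable01 f ->
  primitive (fun t => c * f t) r = c * primitive f r.
Proof.
move=> fi; rewrite /primitive RintegralZl//.
by apply: integrable01_sub fi; rewrite ?bnd_simp//; have /andP[] := clamp01 r.
Qed.

Lemma integrable01Z f (c : R) : integrable01 f -> integrable01 (fun t => c * f t).
Proof. by move=> fi; exact: (integrableZl _ c fi). Qed.

Lemma primitive_ndecr f : integrable01 f -> (forall t, 0 <= t <= 1 -> 0 <= f t) ->
  {homo primitive f : a b / a <= b}.
Proof.
move=> fi f0 a b ab; rewrite -subr_ge0.
have := @primitive_le (cst 0) f a b _ fi ab _.
rewrite !primitive_cst !mul0r subrr; apply; first exact/continuous_integrable01/cst_continuous.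
by move=> t t01 _; exact: f0.
Qed.

Lemma primitive_lip f (C a b : R) : integrable01 f -> 0 <= C ->
  (forall t, 0 <= t <= 1 -> f t <= C) -> a <= b ->
  primitive f b - primitive f a <= C * (b - a).
Proof.
move=> fi C0 f1 ab; apply: le_trans (ler_wpM2l C0 (clamp_lip ab)).
have := @primitive_le f (cst C) a b fi _ ab _.
rewrite !primitive_cst -mulrBr; apply; first exact/continuous_integrable01/cst_continuous.
by move=> t t01 _; exact: f1.
Qed.

Lemma primitive_continuous f (C : R) : integrable01 f ->
  (forall t, 0 <= t <= 1 -> 0 <= f t <= C) -> continuous (primitive f).
Proof.
move=> fi f01 x; apply/cvgrPdist_le => e e0.
have f0 t : 0 <= t <= 1 -> 0 <= f t by move=> /f01/andP[].
have f1 t : 0 <= t <= 1 -> f t <= C by move=> /f01/andP[].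
have C0 : 0 <= C.
  by have /andP[] := f01 0 (introT andP (conj (lexx 0) ler01)); exact: le_trans.
have d0 : 0 < e / (C + 1) by rewrite divr_gt0// ltr_wpDl.
near=> y.
have h : `|x - y| < e / (C + 1) by near: y; apply: cvgr_dist_lt d0; exact: cvg_id.
have : C * `|x - y| <= e.
  apply: (@le_trans _ _ ((C + 1) * `|x - y|)); first by rewrite ler_wpM2r// lerDl.
  by rewrite mulrC -ler_pdivlMr ?ltr_wpDl// ltW.
apply: le_trans.
have [xy|yx] := leP x y.
  rewrite (distrC (primitive f x)) (distrC x) (ger0_norm (_ : 0 <= y - x)) ?subr_ge0//.
  rewrite ger0_norm ?subr_ge0; first exact: (primitive_lip fi C0 f1 xy).
  exact: (primitive_ndecr fi f0 xy).
rewrite (ger0_norm (_ : 0 <= x - y)) ?subr_ge0 ?(ltW yx)//.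
rewrite ger0_norm ?subr_ge0; first exact: (primitive_lip fi C0 f1 (ltW yx)).
exact: (primitive_ndecr fi f0 (ltW yx)).
Unshelve. all: by end_near.
Qed.

Lemma primitive_ge_cst f (C a b : R) : integrable01 f -> 0 <= a -> a <= b -> b <= 1 ->
  (forall t, a < t <= b -> C <= f t) -> C * (b - a) <= primitive f b - primitive f a.
Proof.
move=> fi a0 ab b1 Cf.
have ca : clamp a = a by rewrite clamp_id// a0 (le_trans ab).
have cb : clamp b = b by rewrite clamp_id// b1 (le_trans a0).
rewrite mulrBr -{1}ca -{1}cb -!primitive_cst.
apply: primitive_le => //; first exact/continuous_integrable01/cst_continuous.
by move=> t _; rewrite ca cb; exact: Cf.
Qed.

Lemma primitive_le_cst f (C a b : R) : integrable01 f -> 0 <= a -> a <= b -> b <= 1 ->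
  (forall t, a < t <= b -> f t <= C) -> primitive f b - primitive f a <= C * (b - a).
Proof.
move=> fi a0 ab b1 Cf.
have ca : clamp a = a by rewrite clamp_id// a0 (le_trans ab).
have cb : clamp b = b by rewrite clamp_id// b1 (le_trans a0).
rewrite mulrBr -{2}ca -{2}cb -!primitive_cst.
apply: primitive_le => //; first exact/continuous_integrable01/cst_continuous.
by move=> t _; rewrite ca cb; exact: Cf.
Qed.

Lemma primitive_exp (n : nat) (r : R) : (0 < n)%N ->
  primitive (fun t => n%:R * t ^+ n.-1) r = clamp r ^+ n.
Proof.
move=> n0; have /andP[r0 r1] := clamp01 r.
move: r0; rewrite /primitive le_eqVlt => /predU1P[<-|r0].
  by rewrite set_itv1 Rintegral_set1 expr0n gtn_eqF.
have c : continuous (fun t : R => n%:R * t ^+ n.-1).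
  move=> t; have c1 : {for t, continuous (fun _ : R => n%:R : R)} by exact: cst_continuous.
  by have := continuousM c1 (@exprn_continuous R n.-1 t).
have d (x : R) : is_derive x 1 (fun t : R => t ^+ n) (n%:R * x ^+ n.-1).
  split; first exact: exprn_derivable.
  by rewrite -derive1E -(prednK n0) exp_derive1.
rewrite /Rintegral (@continuous_FTC2 _ _ (fun t => t ^+ n))//=.
- by rewrite expr0n gtn_eqF// subr0.
- exact: continuous_subspaceT.
- split.
  + by move=> x _; have [] := d x.
  + by apply: cvg_at_right_filter; exact: exprn_continuous.
  + by apply: cvg_at_left_filter; exact: exprn_continuous.
- by move=> x _; rewrite derive1E; have [] := d x.
Qed.

End Primitive.

Lemma continuous_cstB (R : realType) (a : R) (f : R -> R) :
  continuous f -> continuous (fun r => a - f r).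
Proof.
move=> fc x; have c1 : {for x, continuous (fun _ : R => a)} by exact: cst_continuous.
exact: continuousB c1 (fc x).
Qed.

(* Otherwise failed unifications unfold the integrals. *)
Opaque primitive.

(** * The solution operator of the radial equation *)

Section RadialOperator.
Context (R : realType) (n : nat) (n0 : (0 < n)%N).
Implicit Types (w : R -> R) (gamma : R).

(** Monotonicity gives measurability, the bounds give integrability, and both survive pointwise
    suprema of nonempty families; continuity would not. *)
Definition admissible w : Prop :=
  nonincreasing_fun w /\ forall r, 0 <= w r <= 1.

(* For u = - z (|x|), det D^2 u = w (|x|)^gamma reads
   ((- z')^n)' = n r^(n-1) w^gamma; below - z' is slope and z is solve. *)
Definition mass_density gamma w (t : R) : R := n%:R * t ^+ n.-1 * w t `^ gamma.

Definition mass gamma w : R -> R := primitive (mass_density gamma w).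

Definition slope gamma w (r : R) : R := mass gamma w r `^ n%:R^-1.

Definition solve gamma w (r : R) : R :=
  primitive (slope gamma w) 1 - primitive (slope gamma w) r.

Let pow_continuous : continuous (fun t : R => n%:R * t ^+ n.-1).
Proof.
move=> t; have c1 : {for t, continuous (fun _ : R => n%:R : R)} by exact: cst_continuous.
by have := continuousM c1 (@exprn_continuous R n.-1 t).
Qed.

Let pow_int : integrable01 (fun t : R => n%:R * t ^+ n.-1).
Proof. exact: continuous_integrable01. Qed.

Lemma powR_admissible gamma w : 0 < gamma -> admissible w ->
  admissible (fun r => w r `^ gamma).
Proof.
move=> g0 [wn w01]; split => [r s rs|r].
  apply: ge0_ler_powR; rewrite ?nnegrE ?(ltW g0) ?wn//.
    by have /andP[] := w01 s.
  by have /andP[] := w01 r.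
have /andP[wr0 wr1] := w01 r; rewrite powR_ge0/=.
have e : (1 : R) `^ gamma = 1 by rewrite powR1.
by rewrite -[leRHS]e; apply: ge0_ler_powR; rewrite ?nnegrE ?ler01 ?(ltW g0).
Qed.

Lemma mass_density_bounds gamma w : 0 < gamma -> admissible w ->
  forall t, 0 <= t <= 1 -> 0 <= mass_density gamma w t <= n%:R.
Proof.
move=> g0 aw t /andP[t0 t1]; have [_ /(_ t)/andP[f0 f1]] := powR_admissible g0 aw.
rewrite /mass_density !mulr_ge0 ?exprn_ge0//= -[leRHS]mulr1.
rewrite ler_pM ?mulr_ge0 ?exprn_ge0// -[leRHS]mulr1 ler_wpM2l//.
by rewrite exprn_ile1.
Qed.

Lemma mass_density_integrable gamma w : 0 < gamma -> admissible w ->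
  integrable01 (mass_density gamma w).
Proof.
move=> g0 aw; have [wn _] := powR_admissible g0 aw.
apply: measurable_integrable01 (mass_density_bounds g0 aw).
apply: measurable_funM; first exact: continuous_measurable_fun pow_continuous.
exact: nonincreasing_measurable.
Qed.

(** On [0, r] the nonincreasing [w] lies between [w r] and [w 0], and [n t^(n-1)] integrates to
    [r^n]. The same reason gives [mass_ge]. *)
Lemma mass_le gamma w (r : R) : 0 < gamma -> admissible w -> 0 <= r <= 1 ->
  mass gamma w r <= w 0 `^ gamma * r ^+ n.
Proof.
move=> g0 aw /[dup] r01 /andP[r0 r1]; have [fn f01] := powR_admissible g0 aw.
have := @primitive_le _ (mass_density gamma w) (fun t => w 0 `^ gamma * (n%:R * t ^+ n.-1)) 0 r.
rewrite !primitive0 !subr0 primitiveZ// primitive_exp// (clamp_id r01); apply => //.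
- exact: mass_density_integrable.
- exact: integrable01Z.
move=> t /andP[t0 t1] _; rewrite /mass_density mulrC ler_wpM2r ?mulr_ge0 ?exprn_ge0//.
exact: fn.
Qed.

Lemma mass_ge gamma w (r : R) : 0 < gamma -> admissible w -> 0 <= r <= 1 ->
  w r `^ gamma * r ^+ n <= mass gamma w r.
Proof.
move=> g0 aw /[dup] r01 /andP[r0 r1]; have [fn f01] := powR_admissible g0 aw.
have := @primitive_le _ (fun t => w r `^ gamma * (n%:R * t ^+ n.-1)) (mass_density gamma w) 0 r.
rewrite !primitive0 !subr0 primitiveZ// primitive_exp// (clamp_id r01); apply => //.
- exact: integrable01Z.
- exact: mass_density_integrable.
move=> t /andP[t0 t1] /andP[_ tr]; rewrite /mass_density mulrC ler_wpM2l ?mulr_ge0 ?exprn_ge0//.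
exact: fn.
Qed.

Lemma mass_density_ge0 gamma w (t : R) : 0 <= t <= 1 -> 0 <= mass_density gamma w t.
Proof. by move=> /andP[t0 t1]; rewrite /mass_density !mulr_ge0 ?exprn_ge0 ?powR_ge0. Qed.

Lemma mass_ndecr gamma w : 0 < gamma -> admissible w ->
  {homo mass gamma w : a b / a <= b}.
Proof.
move=> g0 aw; apply: primitive_ndecr; first exact: mass_density_integrable.
exact: mass_density_ge0.
Qed.

Lemma mass_ge0 gamma w (r : R) : 0 <= mass gamma w r.
Proof.
by apply: primitive_ge0; exact: mass_density_ge0.
Qed.

Lemma invn_ge0 : 0 <= (n%:R : R)^-1.
Proof. by rewrite invr_ge0. Qed.

Lemma powR_root (x : R) : 0 <= x -> (x ^+ n) `^ n%:R^-1 = x.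
Proof.
move=> x0; rewrite -powR_mulrn// -powRrM mulfV ?powRr1//.
by rewrite pnatr_eq0 -lt0n.
Qed.

Lemma slope_ge0 gamma w (r : R) : 0 <= slope gamma w r.
Proof. exact: powR_ge0. Qed.

Lemma slope_ndecr gamma w : 0 < gamma -> admissible w ->
  {homo slope gamma w : a b / a <= b}.
Proof.
move=> g0 aw a b ab; apply: ge0_ler_powR; rewrite ?nnegrE ?mass_ge0 ?invn_ge0//.
exact: mass_ndecr.
Qed.

Lemma slope_le gamma w (r : R) : 0 < gamma -> admissible w -> 0 <= r <= 1 ->
  slope gamma w r <= r.
Proof.
move=> g0 aw /[dup] r01 /andP[r0 r1].
rewrite -[leRHS]powR_root//; apply: ge0_ler_powR; rewrite ?nnegrE ?mass_ge0 ?invn_ge0 ?exprn_ge0//.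
apply: le_trans (mass_le g0 aw r01) _; rewrite ler_piMl ?exprn_ge0//.
by have [_ /(_ 0)/andP[]] := powR_admissible g0 aw.
Qed.

Lemma slope_ge gamma w (r : R) : 0 < gamma -> admissible w -> 0 <= r <= 1 ->
  w r `^ (gamma / n%:R) * r <= slope gamma w r.
Proof.
move=> g0 aw /[dup] r01 /andP[r0 r1].
rewrite powRrM -[X in _ * X <= _]powR_root// -powRM ?powR_ge0 ?exprn_ge0//.
apply: ge0_ler_powR; rewrite ?nnegrE ?mass_ge0 ?invn_ge0 ?mulr_ge0 ?powR_ge0 ?exprn_ge0//.
exact: mass_ge.
Qed.

Lemma slope01 gamma w : 0 < gamma -> admissible w ->
  forall t, 0 <= t <= 1 -> 0 <= slope gamma w t <= 1.
Proof.
move=> g0 aw t t01; rewrite slope_ge0 (le_trans (slope_le g0 aw t01))//.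
by case/andP : t01.
Qed.

Lemma slope_integrable gamma w : 0 < gamma -> admissible w ->
  integrable01 (slope gamma w).
Proof.
move=> g0 aw; apply: (@measurable_integrable01 _ _ 1); last exact: slope01.
by apply: nondecreasing_measurable; [exact: measurableT|exact: slope_ndecr].
Qed.

Lemma solve_le gamma w (r : R) : 0 < gamma -> admissible w -> 0 <= r <= 1 ->
  solve gamma w r <= 1 - r.
Proof.
move=> g0 aw /andP[r0 r1]; rewrite -[leRHS]mul1r.
have s1 t : 0 <= t <= 1 -> slope gamma w t <= 1 by move=> /(slope01 g0 aw)/andP[].
exact: (primitive_lip (slope_integrable g0 aw) ler01 s1 r1).
Qed.

Lemma solve_admissible gamma w : 0 < gamma -> admissible w ->
  admissible (solve gamma w).
Proof.
move=> g0 aw; have nd := primitive_ndecr (slope_integrable g0 aw) (fun t _ => slope_ge0 _ _ t).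
split => [a b ab|r]; first by rewrite lerD2l lerN2 nd.
rewrite /solve -(primitive_clamp _ r) -/(solve gamma w (clamp r)).
have /andP[r0 r1] := clamp01 r.
rewrite subr_ge0 nd//= (le_trans (solve_le g0 aw (clamp01 r)))//.
by rewrite gerDl oppr_le0.
Qed.

Lemma solve_mono gamma w w' : 0 < gamma -> admissible w -> admissible w' ->
  (forall r, w r <= w' r) -> forall r, solve gamma w r <= solve gamma w' r.
Proof.
move=> g0 aw aw' ww' r.
have mm t : mass gamma w t <= mass gamma w' t.
  have [t0|t0] := leP 0 t; last first.
    rewrite /mass (primitive_npos (mass_density gamma w) (ltW t0)).
    by rewrite (primitive_npos (mass_density gamma w') (ltW t0)).
  have := primitive_le (mass_density_integrable g0 aw) (mass_density_integrable g0 aw') t0.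
  rewrite (primitive0 (mass_density gamma w)) (primitive0 (mass_density gamma w')).
  rewrite -/(mass gamma w t) -/(mass gamma w' t); move: (mass _ w) (mass _ w') => m m'.
  rewrite !subr0; apply=> s /andP[s0 s1] _.
  rewrite /mass_density ler_wpM2l ?mulr_ge0 ?exprn_ge0//.
  apply: ge0_ler_powR; rewrite ?nnegrE ?(ltW g0)//.
    by have [_ /(_ s)/andP[]] := aw.
  by have [_ /(_ s)/andP[]] := aw'.
have ss t : slope gamma w t <= slope gamma w' t.
  by apply: ge0_ler_powR; rewrite ?nnegrE ?mass_ge0 ?invn_ge0.
have E v : solve gamma v r = primitive (slope gamma v) 1 - primitive (slope gamma v) (clamp r).
  by rewrite primitive_clamp.
rewrite !E; apply: primitive_le.
- exact: slope_integrable.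
- exact: slope_integrable.
- by have /andP[] := clamp01 r.
- by move=> t _ _.
Qed.

(** The slope is nondecreasing, so beyond 1/2 it is at least its value at 1/2, where [w] is at least
    [c / 2]: this gives the power of 1/2. In the factor 1/4, one half is the radius 1/2 in
    [slope_ge] and the other comes from [1 - max (r, 1/2) >= (1 - r) / 2]. *)
Definition cone_rate gamma : R := 2^-1 `^ (gamma / n%:R) / 4.

Lemma solve_ge gamma w (c : R) : 0 < gamma -> admissible w -> 0 <= c ->
  (forall r, 0 <= r <= 1 -> c * (1 - r) <= w r) ->
  forall r, 0 <= r <= 1 ->
    c `^ (gamma / n%:R) * cone_rate gamma * (1 - r) <= solve gamma w r.
Proof.
move=> g0 aw c0 cw r /andP[r0 r1].
have gn : 0 <= gamma / n%:R by rewrite divr_ge0// ltW.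
have h01 : 0 <= (2^-1 : R) <= 1 by lra.
pose d := c `^ (gamma / n%:R) * (2^-1 `^ (gamma / n%:R) / 2).
have d0 : 0 <= d by rewrite mulr_ge0 ?divr_ge0 ?powR_ge0.
have sd : d <= slope gamma w 2^-1.
  apply: le_trans (slope_ge g0 aw h01).
  rewrite /d mulrA ler_wpM2r// -powRM//.
  have cw2 : c * 2^-1 <= w 2^-1 by apply: le_trans (cw _ h01); lra.
  apply: ge0_ler_powR; rewrite ?nnegrE// ?mulr_ge0//.
  by apply: le_trans cw2; rewrite mulr_ge0.
pose m := Num.max r 2^-1.
have rm : r <= m by rewrite le_max lexx.
have hm : 2^-1 <= m by rewrite le_max lexx orbT.
have m1 : m <= 1 by rewrite ge_max r1; lra.
have nd := primitive_ndecr (slope_integrable g0 aw) (fun t _ => slope_ge0 _ _ t).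
apply: (@le_trans _ _ (primitive (slope gamma w) 1 - primitive (slope gamma w) m)); last first.
  by rewrite lerD2l lerN2 nd.
have m0 : 0 <= m by apply: le_trans hm; case/andP : h01.
have dm t : m < t <= 1 -> d <= slope gamma w t.
  move=> /andP[mt _]; apply: le_trans sd _; apply: slope_ndecr => //.
  exact: le_trans hm (ltW mt).
apply: le_trans (primitive_ge_cst (slope_integrable g0 aw) m0 m1 (lexx 1) dm).
have : d * ((1 - r) / 2) <= d * (1 - m).
  by apply: ler_wpM2l => //; rewrite /m; case: (leP r 2^-1) => _; lra.
by rewrite /d /cone_rate; lra.
Qed.

Lemma solve_continuous gamma w : 0 < gamma -> admissible w -> continuous (solve gamma w).
Proof.
move=> g0 aw; apply: continuous_cstB.
exact: primitive_continuous (slope_integrable g0 aw) (slope01 g0 aw).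
Qed.

(* Knaster--Tarski: the pointwise supremum of the admissible w above the cone
   c (1 - r) with w <= S w is a fixed point of S = solve alpha \o solve beta;
   c is chosen so that S preserves the lower bound. *)
Lemma solve_fixed_point (alpha beta : R) : 0 < alpha -> 0 < beta ->
  alpha * beta < n%:R ^+ 2 ->
  exists w1 w2 : R -> R, exists2 c, 0 < c &
    [/\ admissible w1 /\ admissible w2,
        w1 = solve alpha w2, w2 = solve beta w1 &
        forall r, 0 <= r <= 1 -> c * (1 - r) <= w1 r /\ c * (1 - r) <= w2 r].
Proof.
move=> a0 b0 ab.
have nR : 0 < n%:R :> R by rewrite ltr0n.
pose p := beta / n%:R * (alpha / n%:R).
have p1 : p < 1.
  have -> : p = alpha * beta / n%:R ^+ 2 by rewrite /p; field; rewrite lt0r_neq0.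
  by rewrite ltr_pdivrMr ?exprn_gt0// mul1r.
pose k := cone_rate beta `^ (alpha / n%:R) * cone_rate alpha.
have rate0 g : 0 < cone_rate g by rewrite divr_gt0 ?powR_gt0 ?invr_gt0.
have k0 : 0 < k by rewrite mulr_gt0 ?powR_gt0.
(* Two uses of [solve_ge] turn the height [c] into [c^p k], and this [c] has
   [c^(1 - p) = min (1, k) <= k]. The 1 gives [c <= 1], so that the cone itself is admissible. *)
pose c := Num.min 1 k `^ (1 - p)^-1.
have mk0 : 0 < Num.min 1 k by rewrite lt_min ltr01 k0.
have c0 : 0 < c by rewrite powR_gt0.
have p1' : 0 < 1 - p by rewrite subr_gt0.
have c1 : c <= 1.
  have e : (1 : R) `^ (1 - p)^-1 = 1 by rewrite powR1.
  rewrite -[leRHS]e; apply: ge0_ler_powR; rewrite ?nnegrE ?invr_ge0 ?(ltW p1') ?(ltW mk0)//.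
  by rewrite ge_min lexx.
have ck : c <= c `^ p * k.
  have cE : c `^ (1 - p) = Num.min 1 k.
    by rewrite /c -powRrM mulVf ?lt0r_neq0// powRr1 ?(ltW mk0).
  have h : c = c `^ p * c `^ (1 - p).
    rewrite -powRD; last by rewrite lt0r_neq0// implybT.
    by rewrite [p + _]addrC subrK powRr1 ?(ltW c0).
  by rewrite [leLHS]h cE ler_wpM2l ?powR_ge0// ge_min lexx orbT.
pose S w := solve alpha (solve beta w).
pose K w := admissible w /\ forall r, 0 <= r <= 1 -> c * (1 - r) <= w r.
have KS w : K w -> K (S w).
  move=> [aw cw]; have aw2 := solve_admissible b0 aw.
  split; first exact: solve_admissible.
  move=> r r01; have rr : 0 <= 1 - r by case/andP : r01 => *; rewrite subr_ge0.
  pose c2 := c `^ (beta / n%:R) * cone_rate beta.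
  have c20 : 0 <= c2 by rewrite mulr_ge0 ?powR_ge0// ltW.
  have := solve_ge a0 aw2 c20 (solve_ge b0 aw (ltW c0) cw) r01.
  apply: le_trans; rewrite ler_wpM2r// (le_trans ck)//.
  rewrite /c2 powRM ?powR_ge0 ?(ltW (rate0 _))//.
  by rewrite /p powRrM /k mulrA.
have Smono w w' : admissible w -> admissible w' -> (forall r, w r <= w' r) ->
    forall r, S w r <= S w' r.
  move=> aw aw' ww'.
  apply: (solve_mono a0 (solve_admissible b0 aw) (solve_admissible b0 aw')).
  exact: (solve_mono b0 aw aw' ww').
pose X := [set w | K w /\ forall r, w r <= S w r].
(* The cone, frozen outside [0, 1]; it belongs to [X], so the suprema below are over nonempty
   sets. *)
pose e r : R := c * (1 - clamp r).
have Ke : K e.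
  split; last by move=> r r01; rewrite /e clamp_id.
  split=> [r s rs|r]; first by rewrite ler_pM2l// lerD2l lerN2 clamp_le.
  have /andP[r0 r1] := clamp01 r.
  rewrite /e mulr_ge0 ?(ltW c0) ?subr_ge0//= -[leRHS]mulr1 ler_pM ?(ltW c0) ?subr_ge0//.
  by rewrite gerBl.
have solve_clamp g w r : solve g w r = solve g w (clamp r).
  by rewrite /solve primitive_clamp.
have Xe : X e.
  split=> // r; rewrite /S solve_clamp; apply: (KS _ Ke).2; exact: clamp01.
pose W r := sup [set w r | w in X].
have hs r : has_sup [set w r | w in X].
  split; first by exists (e r); exists e.
  by exists 1 => _ [w [[[_ w01] _] _] <-]; case/andP : (w01 r).
have WX w r : X w -> w r <= W r.
  by move=> Xw; apply: ub_le_sup; [exact: (hs r).2|exists w].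
have aW : admissible W.
  split=> [r s rs|r].
    apply: ge_sup; first exact: (hs s).1.
    move=> _ [w Xw <-]; have [[[wn _] _] _] := Xw.
    exact: le_trans (wn _ _ rs) (WX w r Xw).
  apply/andP; split; last first.
    apply: ge_sup; first exact: (hs r).1.
    by move=> _ [w [[[_ w01] _] _] <-]; case/andP : (w01 r).
  apply: le_trans (WX e r Xe); have [[_ /(_ r)/andP[]]] := Ke; by [].
have KW : K W.
  split=> // r r01; apply: le_trans (WX e r Xe).
  by have [_] := Ke; exact.
have WS r : W r <= S W r.
  apply: ge_sup; first exact: (hs r).1.
  move=> _ [w Xw <-]; have [[aw _] wS] := Xw.
  apply: le_trans (wS r) _; by apply: (Smono _ _ aw aW) => s; exact: WX.
have KSW := KS _ KW.
(* As a member of [X], [S W] lies below the supremum [W], the inequality still missing. *)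
have SWX : X (S W).
  split; first exact: KSW.
  exact: (Smono _ _ aW KSW.1 WS).
have E : W = S W.
  by apply/funext => r; apply/eqP; rewrite eq_le WS WX.
pose c2 := c `^ (beta / n%:R) * cone_rate beta.
have c20 : 0 < c2 by rewrite mulr_gt0 ?powR_gt0.
exists W, (solve beta W), (Num.min c c2); first by rewrite lt_min c0 c20.
have aW2 := solve_admissible b0 aW.
apply: And4.
  exact: conj aW aW2.
  exact: E.
  exact: erefl.
move=> r r01; have rr : 0 <= 1 - r by case/andP : r01 => *; rewrite subr_ge0.
split.
  by apply: le_trans (KW.2 r r01); rewrite ler_wpM2r// ge_min lexx.
apply: le_trans (solve_ge b0 aW (ltW c0) KW.2 r01).
by rewrite ler_wpM2r// ge_min lexx orbT.
Qed.

End RadialOperator.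

(** * Regularity of the radial solution *)

Lemma powR_root_slope (R : realType) (n : nat) (s k : R) : (0 < n)%N -> 0 < s ->
  n%:R^-1 * (s ^+ n) `^ (n%:R^-1 - 1) * (n%:R * k) = k / s ^+ n.-1.
Proof.
move=> n0 s0; have nR : n%:R != 0 :> R by rewrite pnatr_eq0 -lt0n.
have sn : 0 < s ^+ n by rewrite exprn_gt0.
rewrite powRB; last by rewrite lt0r_neq0// implybT.
rewrite (powR_root n0 (ltW s0)) powRr1 ?(ltW sn)//.
have -> : s ^+ n = s * s ^+ n.-1 by rewrite -exprS prednK.
field.
by rewrite !lt0r_neq0 ?exprn_gt0 ?ltr0n.
Qed.

(** Zeros of [f] must be allowed: the radial functions vanish at r = 1, where a power with exponent
    below 1 is continuous but not differentiable. *)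
Lemma continuous_powR (R : realType) (f : R -> R) (p : R) : 0 < p ->
  (forall t, 0 <= f t) -> continuous f -> continuous (fun t => f t `^ p).
Proof.
move=> p0 f0 fc s; have := f0 s; rewrite le_eqVlt => /predU1P[fs|fs]; last first.
  have c : {for f s, continuous (@powR R ^~ p)}.
    have [d _] := is_derive1_powR p fs.
    by apply: differentiable_continuous; exact/derivable1_diffP.
  exact: (@continuous_comp _ _ _ f (@powR R ^~ p) s (fc s) c).
rewrite /continuous_at -fs powR0 ?gt_eqF//.
apply/cvgrPdist_lt => e e0.
have d0 : 0 < e `^ p^-1 by rewrite powR_gt0.
have /cvgrPdist_lt/(_ _ d0) := fc s.
apply: filterS => t; rewrite -fs !sub0r !normrN !ger0_norm ?powR_ge0// => ft.
have -> : e = (e `^ p^-1) `^ p by rewrite -powRrM mulVf ?powRr1 ?(ltW e0)// gt_eqF.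
by apply: gt0_ltr_powR; rewrite ?nnegrE ?f0 ?(ltW d0).
Qed.

Section RadialSolution.
Context (R : realType) (n : nat) (n0 : (0 < n)%N) (gamma : R) (g0 : 0 < gamma).
Context (v : R -> R) (av : admissible v) (vc : continuous v).
Context (vpos : forall r, 0 <= r < 1 -> 0 < v r).

Notation M := (mass n gamma v).
Notation D := (slope n gamma v).

Lemma mass_continuous : continuous M.
Proof.
exact: primitive_continuous (mass_density_integrable n g0 av)
  (mass_density_bounds n g0 av).
Qed.

Lemma slope_gt0 (r : R) : 0 < r -> 0 < D r.
Proof.
move=> r0; pose m := Num.min r 2^-1.
have m0 : 0 < m by rewrite lt_min r0 invr_gt0 ltr0n.
have mr : m <= r by rewrite ge_min lexx.
have mh : m <= 2^-1 by rewrite ge_min lexx orbT.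
have m1 : m < 1 by apply: le_lt_trans mh _; lra.
apply: lt_le_trans (slope_ndecr n g0 av mr).
have m01 : 0 <= m <= 1 by rewrite !ltW.
apply: lt_le_trans (slope_ge n0 g0 av m01).
by rewrite mulr_gt0// powR_gt0// vpos// (ltW m0) m1.
Qed.

Lemma mass_gt0 (r : R) : 0 < r -> 0 < M r.
Proof.
by move=> /slope_gt0; apply: gt0_powR; rewrite ?mass_ge0// invr_gt0 ltr0n.
Qed.

Lemma slope_continuous (r : R) : 0 < r -> {for r, continuous D}.
Proof.
move=> r0; have c1 : {for M r, continuous (@powR R ^~ n%:R^-1)}.
  have [d _] := is_derive1_powR (n%:R^-1) (mass_gt0 r0).
  by apply: differentiable_continuous; exact/derivable1_diffP.
exact: (@continuous_comp _ _ _ M (@powR R ^~ n%:R^-1) r (@mass_continuous r) c1).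
Qed.

(** Differentiating [D^n = M] gives [n D^(n-1) D' = n r^(n-1) v^gamma]. *)
Lemma is_derive_slope (r : R) : 0 < r < 1 ->
  is_derive r 1 D (v r `^ gamma * (r / D r) ^+ n.-1).
Proof.
move=> /[dup] r01 /andP[r0 r1].
have fc : {for r, continuous (mass_density n gamma v)}.
  have c1 : {for r, continuous (fun _ : R => n%:R : R)} by exact: cst_continuous.
  have c2 : {for v r, continuous (@powR R ^~ gamma)}.
    have vr : 0 < v r by rewrite vpos// (ltW r0).
    have [d _] := is_derive1_powR gamma vr.
    by apply: differentiable_continuous; exact/derivable1_diffP.
  have c3 := @continuous_comp _ _ _ v (@powR R ^~ gamma) r (@vc r) c2.
  exact: continuousM (continuousM c1 (@exprn_continuous R n.-1 r)) c3.
have dm := is_derive_primitive (mass_density_integrable n g0 av) r01 fc.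
have m0 := mass_gt0 r0.
have := is_derive1_comp (is_derive1_powR n%:R^-1 m0) dm.
have sE : M r = D r ^+ n.
  rewrite -powR_mulrn ?slope_ge0// -powRrM mulVf ?powRr1 ?(ltW m0)//.
  by rewrite pnatr_eq0 -lt0n.
rewrite sE -(mulrA n%:R^-1) (mulrA n%:R^-1) => h.
have := h; congr is_derive; rewrite /mass_density -[n%:R * _ * _]mulrA.
by rewrite powR_root_slope ?slope_gt0// expr_div_n; ring.
Qed.

(** For u = - z (r) with r = sqrt s this is u' / r, the tangential eigenvalue. The value for
    [s <= 0] is its limit at the centre, so that continuity at 0 is two-sided. *)
Definition radial_A (s : R) : R :=
  if s <= 0 then v 0 `^ (gamma / n%:R) else D (Num.sqrt s) / Num.sqrt s.

(** This is u'' - u' / r, with u'' eliminated through the equation [A^(n-1) u'' = v^gamma]; the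
    determinant identity thus holds by construction, and what remains to prove is that [A] has
    derivative [q / (2 s)]. *)
Definition radial_q (s : R) : R :=
  v (Num.sqrt s) `^ gamma / radial_A s ^+ n.-1 - radial_A s.

Lemma radial_A_gt0 (s : R) : 0 < radial_A s.
Proof.
rewrite /radial_A; case: ifPn => [_|].
  by rewrite powR_gt0// vpos// lexx ltr01.
by rewrite -ltNge => s0; rewrite divr_gt0 ?slope_gt0 ?sqrtr_gt0.
Qed.

(** Both bounds agree in the limit s = 0, so squeezing gives continuity of [radial_A] at the
    centre. *)
Lemma radial_A_bounds (s : R) : s < 1 ->
  v (Num.sqrt s) `^ (gamma / n%:R) <= radial_A s <= v 0 `^ (gamma / n%:R).
Proof.
move=> s1; rewrite /radial_A; case: ifPn => [s0|].
  by rewrite ler0_sqrtr// lexx.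
rewrite -ltNge => s0; have r0 : 0 < Num.sqrt s by rewrite sqrtr_gt0.
have r1 : Num.sqrt s < 1 by rewrite -sqrtr1 ltr_sqrt.
have r01 : 0 <= Num.sqrt s <= 1 by rewrite !ltW.
rewrite ler_pdivlMr// ler_pdivrMr// (slope_ge n0 g0 av r01)/=.
have vg : 0 <= v 0 `^ gamma by exact: powR_ge0.
rewrite powRrM -[X in _ <= _ * X](powR_root n0 (ltW r0)) -powRM ?exprn_ge0 ?(ltW r0)//.
apply: ge0_ler_powR; rewrite ?nnegrE ?invn_ge0 ?mass_ge0 ?mulr_ge0 ?exprn_ge0 ?(ltW r0)//.
exact: mass_le.
Qed.

Lemma powR_comp_continuous (p : R) : 0 < p ->
  continuous (fun s => v (Num.sqrt s) `^ p).
Proof.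
move=> p0; apply: continuous_powR => // [t|s].
  by have [_ /(_ (Num.sqrt t))/andP[]] := av.
exact: (@continuous_comp _ _ _ (@Num.sqrt R) v s (@sqrt_continuous R s) (@vc (Num.sqrt s))).
Qed.

Lemma gamma_n_gt0 : 0 < gamma / n%:R.
Proof. by rewrite divr_gt0// ltr0n. Qed.

Lemma radial_A_continuous : continuous radial_A.
Proof.
move=> s; have [s0|s0] := leP s 0.
  have c := @powR_comp_continuous _ gamma_n_gt0 s.
  have E : radial_A s = v 0 `^ (gamma / n%:R) by rewrite /radial_A s0.
  rewrite /continuous_at E; apply: (squeeze_cvgr _ _ (cvg_cst _)); last first.
    by move: c; rewrite /continuous_at ler0_sqrtr//; apply.
  near=> t; apply: radial_A_bounds; near: t.
  by apply: lt_nbhsl; exact: le_lt_trans s0 ltr01.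
have r0 : 0 < Num.sqrt s by rewrite sqrtr_gt0.
have c1 : {for s, continuous (fun s => D (Num.sqrt s))}.
  exact: (@continuous_comp _ _ _ (@Num.sqrt R) D s (@sqrt_continuous R s) (slope_continuous r0)).
have c2 : {for s, continuous (fun s => (Num.sqrt s)^-1)}.
  by apply: continuousV; [exact: lt0r_neq0|exact: sqrt_continuous].
have c3 := continuousM c1 c2.
rewrite /continuous_at; have E : radial_A s = D (Num.sqrt s) / Num.sqrt s.
  by rewrite /radial_A leNgt s0.
rewrite E; apply: cvg_trans c3; apply: near_eq_cvg; near=> t.
rewrite /radial_A ifN// -ltNge; near: t.
exact: lt_nbhsr.
Unshelve. all: by end_near.
Qed.

Lemma radial_q_continuous : continuous radial_q.
Proof.
move=> s; have cA := @radial_A_continuous s.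
have c1 : {for s, continuous (fun s => (radial_A s ^+ n.-1)^-1)}.
  apply: continuousV; first by rewrite lt0r_neq0// exprn_gt0// radial_A_gt0.
  exact: (@continuous_comp _ _ _ radial_A (fun x => x ^+ n.-1) s cA (@exprn_continuous R n.-1 _)).
exact: continuousB (continuousM (@powR_comp_continuous _ g0 s) c1) cA.
Qed.

Lemma radial_Aq (s : R) :
  radial_A s ^+ n.-1 * (radial_A s + radial_q s) = v (Num.sqrt s) `^ gamma.
Proof.
by rewrite /radial_q addrC subrK mulrC divfK// lt0r_neq0// exprn_gt0// radial_A_gt0.
Qed.

Lemma radial_q0 : radial_q 0 = 0.
Proof.
rewrite /radial_q /radial_A lexx sqrtr0.
set a := v 0 `^ (gamma / n%:R).
have a0 : 0 < a by rewrite powR_gt0// vpos// lexx ltr01.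
have -> : v 0 `^ gamma = a * a ^+ n.-1.
  rewrite -exprS prednK// -powR_mulrn ?(ltW a0)// -powRrM divfK//.
  by rewrite pnatr_eq0 -lt0n.
by rewrite mulfK ?subrr// lt0r_neq0// exprn_gt0.
Qed.

Lemma sqrt_in01 (s : R) : 0 < s < 1 -> 0 < Num.sqrt s < 1.
Proof. by move=> /andP[s0 s1]; rewrite sqrtr_gt0 s0 -sqrtr1 ltr_sqrt. Qed.

Lemma radial_profile_solve :
  radial_profile (fun s => - solve n gamma v (Num.sqrt s)) radial_A radial_q.
Proof.
split.
- move=> s; apply: (@continuousN _ _ _ (fun s => solve n gamma v (Num.sqrt s))).
  exact: (@continuous_comp _ _ _ (@Num.sqrt R) (solve n gamma v) s
    (@sqrt_continuous R s) (@solve_continuous _ n n0 gamma v g0 av (Num.sqrt s))).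
- exact: radial_A_continuous.
- exact: radial_q_continuous.
- exact: radial_q0.
split.
(* On [0, sqrt s] one has [D t <= t <= sqrt s], so the integral of [D] there is at most s. *)
- exists 1 => s /andP[s0 s1]; rewrite mul1r.
  have r1 : Num.sqrt s <= 1 by rewrite -sqrtr1 ler_sqrt// ltW.
  have r01 : 0 <= Num.sqrt s <= 1 by rewrite sqrtr_ge0.
  have di := slope_integrable n0 g0 av.
  have nd := primitive_ndecr di (fun t _ => slope_ge0 n gamma v t) (sqrtr_ge0 s).
  have e (a b c : R) : - (a - b) - - (a - c) = b - c by ring.
  rewrite sqrtr0 /solve e ger0_norm ?subr_ge0//.
  have ds t : 0 < t <= Num.sqrt s -> D t <= Num.sqrt s.
    move=> /andP[t0 ts]; apply: le_trans (ts); apply: slope_le => //.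
    by rewrite (ltW t0) (le_trans ts).
  apply: le_trans (primitive_le_cst di (lexx 0) (sqrtr_ge0 s) r1 ds) _.
  by rewrite subr0 -expr2 sqr_sqrtr.
- move=> s /[dup] s01 /sqrt_in01 r01; have /andP[s0 _] := s01; have /andP[r0 _] := r01.
  have d1 := is_derive_primitive (slope_integrable n0 g0 av) r01 (slope_continuous r0).
  have := is_derive1_comp d1 (is_derive1_sqrt s0) => d2.
  have := is_deriveB d2 (is_derive_cst (primitive D 1) s 1).
  rewrite /radial_A leNgt s0 /= => d3.
  have E : (fun s => - solve n gamma v (Num.sqrt s)) =
      (primitive D \o Num.sqrt - cst (primitive D 1)).
    by apply/funext => t; rewrite /solve opprB.
  rewrite E; congr is_derive : d3.
  by rewrite subr0; field; rewrite lt0r_neq0.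
- move=> s /[dup] s01 /sqrt_in01 r01; have /andP[s0 _] := s01; have /andP[r0 _] := r01.
  have ds := is_derive1_comp (is_derive_slope r01) (is_derive1_sqrt s0).
  have rn0 : Num.sqrt s != 0 by rewrite lt0r_neq0.
  have di := is_deriveV rn0 (is_derive1_sqrt s0).
  have d3 := is_deriveM ds di.
  apply: (@near_eq_is_derive _ _ _ ((D \o Num.sqrt) * (fun s => (Num.sqrt s)^-1))).
    near=> t; rewrite /radial_A ifN// -ltNge; near: t.
    exact: lt_nbhsr.
  congr is_derive : d3; rewrite /radial_q /radial_A leNgt s0 /= /GRing.scale /=.
  have Ds := slope_gt0 r0; move: (D (Num.sqrt s)) (v _ `^ gamma) Ds => d f d0.
  have sE : s = Num.sqrt s ^+ 2 by rewrite sqr_sqrtr// ltW.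
  rewrite [X in _ = _ / X / 2]sE.
  move: (Num.sqrt s) r0 {rn0 di r01 ds sE} => r r0.
  rewrite !expr_div_n; field.
  by rewrite !lt0r_neq0 ?exprn_gt0.
Unshelve. all: by end_near.
Qed.

Lemma solve_decr : {in `[0, 1] &, {homo solve n gamma v : r s / r < s >-> s < r}}.
Proof.
move=> r s; rewrite !in_itv/= => /andP[r0 r1] /andP[s0 s1] rs.
rewrite /solve ltrD2l ltrN2.
(* The slope vanishes at 0 and [r] may be 0; strictness comes from [m, s], where the slope is at
   least [D m > 0]. *)
pose m := (r + s) / 2.
have rm : r < m by rewrite /m; lra.
have ms : m < s by rewrite /m; lra.
have m0 : 0 < m by exact: le_lt_trans rm.
have di := slope_integrable n0 g0 av.
have nd := primitive_ndecr di (fun t _ => slope_ge0 n gamma v t) (ltW rm).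
apply: le_lt_trans nd _; rewrite -subr_gt0.
have dm t : m < t <= s -> D m <= D t.
  by move=> /andP[mt _]; exact: (slope_ndecr n g0 av (ltW mt)).
apply: lt_le_trans (primitive_ge_cst di (ltW m0) (ltW ms) s1 dm).
by rewrite mulr_gt0 ?slope_gt0 ?subr_gt0.
Qed.

End RadialSolution.

(** * One equation of the system, on the ball *)

Section RadialComponent.
Context (R : realType) (n : nat) (n0 : (0 < n)%N) (gamma : R) (g0 : 0 < gamma).
Context (v : R -> R) (av : admissible v) (vc : continuous v).
Context (vpos : forall r, 0 <= r < 1 -> 0 < v r).

Let w := solve n gamma v.
Let prof := radial_profile_solve n0 g0 av vc vpos.

(** [enorm x] unfolds to the square root of [sqnorm x], so the profile in the variable s applies as
    it stands. *)
Lemma solve_radial_C2 :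
  C2_closure (@unit_ball R n) (fun x => - solve n gamma v (enorm x)).
Proof. exact: radial_C2_closure prof. Qed.

Lemma solve_radial_convex :
  strictly_convex_on (@unit_ball R n) (fun x => - solve n gamma v (enorm x)).
Proof.
apply: (radial_strictly_convex prof) => s /andP[s0 s1].
have A0 := radial_A_gt0 n0 g0 av vpos s; split => //.
rewrite -(pmulr_rgt0 _ (exprn_gt0 n.-1 A0)) radial_Aq//.
by rewrite powR_gt0// vpos// sqrtr_ge0 -sqrtr1 ltr_sqrt.
Qed.

Lemma solve_radial_det (x : 'rV[R]_n) : unit_ball x ->
  \det (hessian (fun x => - solve n gamma v (enorm x)) x) = v (enorm x) `^ gamma.
Proof.
move=> Dx; have A0 := radial_A_gt0 n0 g0 av vpos (sqnorm x).
have E := radial_hessian prof Dx.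
transitivity (\det ((radial_A n gamma v (sqnorm x))%:M +
  (radial_q n gamma v (sqnorm x) / sqnorm x) *: (x^T *m x))).
  by congr (\det _); exact: E.
rewrite det_scalar_rank1 ?lt0r_neq0//.
(* At the centre the quotient by zero gives 0, which is also the value of [radial_q] there. *)
have -> : radial_q n gamma v (sqnorm x) / sqnorm x * sqnorm x = radial_q n gamma v (sqnorm x).
  have [->|s0] := eqVneq (sqnorm x) 0; last by rewrite divfK.
  by rewrite radial_q0// mulr0.
exact: radial_Aq.
Qed.

Lemma solve_radial_increasing :
  radially_increasing (fun x : 'rV[R]_n => - solve n gamma v (enorm x)).
Proof.
exists (fun r => - solve n gamma v r); split=> // r s r01 s01 rs.
by rewrite ltrN2; exact: solve_decr.
Qed.

Lemma solve_radial_boundary (x : 'rV[R]_n) :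
  frontier (@unit_ball R n) x -> - solve n gamma v (enorm x) = 0.
Proof.
move=> /frontier_unit_ball x1; have -> : enorm x = 1.
  by rewrite -[RHS]sqrtr1 -x1.
by rewrite /solve subrr oppr0.
Qed.

End RadialComponent.

(** * Existence, uniqueness and symmetry for the system *)

Theorem theorem5p2 (R : realType) (n : nat) (hn : (2 <= n)%N)
    (alpha beta : R) (halpha : 0 < alpha) (hbeta : 0 < beta)
    (hab : alpha * beta < n%:R ^+ 2) :
  exists u1 u2 : 'rV[R]_n -> R,
    [/\ convex_solution alpha beta u1 u2,
        forall v1 v2 : 'rV[R]_n -> R, convex_solution alpha beta v1 v2 ->
          forall x, closure (@unit_ball R n) x -> v1 x = u1 x /\ v2 x = u2 x
      & radially_increasing u1 /\ radially_increasing u2].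
Proof.
have n0 : (0 < n)%N by exact: leq_trans hn.
have [w1 [w2 [c c0 [[aw1 aw2] E1 E2 cone]]]] := solve_fixed_point n0 halpha hbeta hab.
have pos1 r : 0 <= r < 1 -> 0 < w1 r.
  move=> /andP[r0 r1]; have [h _] := cone r (introT andP (conj r0 (ltW r1))).
  by apply: lt_le_trans h; rewrite mulr_gt0// subr_gt0.
have pos2 r : 0 <= r < 1 -> 0 < w2 r.
  move=> /andP[r0 r1]; have [_ h] := cone r (introT andP (conj r0 (ltW r1))).
  by apply: lt_le_trans h; rewrite mulr_gt0// subr_gt0.
(* Admissibility does not include continuity; it comes from each function being an image of
   [solve]. *)
have c1 : continuous w1 by rewrite E1; exact: solve_continuous.
have c2 : continuous w2 by rewrite E2; exact: solve_continuous.
pose u1 (x : 'rV[R]_n) := - solve n alpha w2 (enorm x).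
pose u2 (x : 'rV[R]_n) := - solve n beta w1 (enorm x).
have u1E x : u1 x = - w1 (enorm x) by rewrite /u1 -E1.
have u2E x : u2 x = - w2 (enorm x) by rewrite /u2 -E2.
have U : convex_solution alpha beta u1 u2.
  have r01 (x : 'rV[R]_n) : unit_ball x -> 0 <= enorm x < 1 by move=> ?; rewrite enorm_ge0.
  split.
  - by split; [exact: solve_radial_C2|exact: solve_radial_C2].
  - by split; [exact: solve_radial_convex|exact: solve_radial_convex].
  - move=> x Dx; rewrite u1E u2E !opprK.
    by split; [exact: solve_radial_det|exact: solve_radial_det].
  - by move=> x Dx; rewrite u1E u2E !oppr_lt0 pos1 ?pos2 ?r01.
  - by move=> x fx; split; exact: solve_radial_boundary.
exists u1, u2; split; first exact: U.
- by move=> v1 v2 V x cx; exact: (convex_solution_unique n0 halpha hbeta hab U V).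
- by split; [exact: solve_radial_increasing|exact: solve_radial_increasing].
Qed.
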